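(* Let $n\ge 3$, let $(\Sigma,g)$ be a smooth closed $(n-1)$-dimensional Riemannian manifold, let $H$ be a smooth function on $\Sigma$ with $H>0$, and let $C<0$ be a constant. Suppose that $$R_g-2H\Delta H^{-1}>0 \quad\text{on } \Sigma$$ and $$\max\left\{\max_\Sigma \frac{n-2}{n-1}\,\frac{H^2}{R_g-2H\Delta H^{-1}},\ \max_\Sigma \frac{H^2r_o^2}{(n-1)^2}\right\}<1-\frac{C}{n(n-1)}\,r_o^2,$$ where $R_g$ is the scalar curvature of $g$ and $r_o$ is the area radius of $(\Sigma,g)$. Then there exists a compact $n$-dimensional Riemannian manifold $(\Omega,\gamma)$ with boundary $\partial\Omega=\Sigma_o\cup\Sigma_H$ such that $\Sigma_o$ (with the induced metric) is isometric to $(\Sigma,g)$ with outward-pointing mean curvature $H$ (under this isometry), $\Sigma_H$ is a minimal surface, and the scalar curvature $R_\gamma$ of $\gamma$ is greater than $C$.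
   Context: $\Delta$ is the Laplace--Beltrami operator of $(\Sigma,g)$ and $H^{-1}=1/H$. The area radius of a closed $(n-1)$-dimensional Riemannian manifold $(\Sigma,g)$ is $r_o=\left(|\Sigma|_g/\omega_{n-1}\right)^{1/(n-1)}$, where $|\Sigma|_g$ is its $(n-1)$-dimensional volume and $\omega_{n-1}$ is the volume of the unit round sphere $S^{n-1}$. Mean curvature is the trace of the second fundamental form, with the convention that the boundary of the unit ball in $\mathbb{R}^n$ has outward-pointing mean curvature $n-1$. A minimal surface is a hypersurface with zero mean curvature. *)

(* Defs.v *)
From HB Require Import structures.
From mathcomp Require Import all_boot all_order all_algebra.
From mathcomp Require Import all_classical all_reals all_analysis.

Set Implicit Arguments.
Unset Strict Implicit.
Unset Printing Implicit Defensive.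

Import Order.TTheory GRing.Theory Num.Theory.
Import numFieldNormedType.Exports.

Local Open Scope classical_set_scope.
Local Open Scope ring_scope.

(** * Calculus on the closed half-space

    Manifolds have charts in the half-space {x | 0 <= x_0}, and all derivatives
    are taken within it: at a point with 0 < x_0 they are the ordinary partial
    derivatives, and at a point with x_0 = 0 the derivative in the direction
    of x_0 is the right derivative. *)

Definition halfspace (R : realType) (m : nat) : set 'rV[R]_m :=
  [set x | forall i : 'I_m, val i = 0%N -> 0 <= x 0 i].

Definition diff_quotient (R : realType) (m : nat) (i : 'I_m)
    (f : 'rV[R]_m -> R) (x : 'rV[R]_m) (h : R) : R :=
  h^-1 * (f (x + h *: delta_mx 0 i) - f x).

Definition admissible_steps (R : realType) (m : nat) (i : 'I_m)
    (x : 'rV[R]_m) : set_system R :=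
  within [set h | halfspace (x + h *: delta_mx 0 i)] (0 : R)^'.

Definition partial (R : realType) (m : nat) (i : 'I_m)
    (f : 'rV[R]_m -> R) (x : 'rV[R]_m) : R :=
  lim (diff_quotient i f x @ admissible_steps i x).

Definition has_partial (R : realType) (m : nat) (i : 'I_m)
    (f : 'rV[R]_m -> R) (x : 'rV[R]_m) : Prop :=
  cvg (diff_quotient i f x @ admissible_steps i x).

(* Only meaningful for [U] relatively open in the half-space. *)
Definition smooth_on (R : realType) (m : nat) (U : set 'rV[R]_m)
    (f : 'rV[R]_m -> R) : Prop :=
  forall s : seq 'I_m, let df := foldr (@partial R m) f s in
    {within U, continuous df} /\
    (forall (i : 'I_m) x, U x -> has_partial i df x).

Definition jacobian (R : realType) (m n : nat)
    (f : 'rV[R]_m -> 'rV[R]_n) (x : 'rV[R]_m) : 'M[R]_(m, n) :=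
  \matrix_(i, k) partial i (fun y => f y 0 k) x.

(** * Riemannian geometry in coordinates *)

(* Gamma^k_{ij} *)
Definition christoffel (R : realType) (m : nat) (G : 'rV[R]_m -> 'M[R]_m)
    (k i j : 'I_m) (x : 'rV[R]_m) : R :=
  2^-1 * \sum_l invmx (G x) k l *
    (partial i (fun y => G y j l) x + partial j (fun y => G y i l) x
     - partial l (fun y => G y i j) x).

Definition ricci (R : realType) (m : nat) (G : 'rV[R]_m -> 'M[R]_m)
    (i j : 'I_m) (x : 'rV[R]_m) : R :=
  \sum_k (partial k (christoffel G k i j) x - partial j (christoffel G k i k) x)
  + \sum_k \sum_l (christoffel G k k l x * christoffel G l i j x
                   - christoffel G k j l x * christoffel G l i k x).

Definition coord_scalar_curvature (R : realType) (m : nat)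
    (G : 'rV[R]_m -> 'M[R]_m) (x : 'rV[R]_m) : R :=
  \sum_i \sum_j invmx (G x) i j * ricci G i j x.

Definition coord_laplacian (R : realType) (m : nat)
    (G : 'rV[R]_m -> 'M[R]_m) (u : 'rV[R]_m -> R) (x : 'rV[R]_m) : R :=
  \sum_i \sum_j invmx (G x) i j *
    (partial i (partial j u) x - \sum_k christoffel G k i j x * partial k u x).

(* The components nu^k of the unit normal of {x_0 = 0} pointing out of the
   half-space, i.e. minus the normalized gradient of x_0. *)
Definition outward_normal (R : realType) (m : nat)
    (G : 'rV[R]_m.+1 -> 'M[R]_m.+1) (x : 'rV[R]_m.+1) (k : 'I_m.+1) : R :=
  - invmx (G x) k ord0 / Num.sqrt (invmx (G x) ord0 ord0).

(* II(d_a, d_b) = <nabla_{d_a} nu, d_b> = - <nu, nabla_{d_a} d_b>, for the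
   tangential directions a, b >= 1; positive for the unit ball. *)
Definition second_fundamental_form (R : realType) (m : nat)
    (G : 'rV[R]_m.+1 -> 'M[R]_m.+1) (x : 'rV[R]_m.+1) : 'M[R]_m :=
  \matrix_(a, b) (- (\sum_k \sum_l G x k l *
     christoffel G k (lift ord0 a) (lift ord0 b) x * outward_normal G x l)).

Definition coord_mean_curvature (R : realType) (m : nat)
    (G : 'rV[R]_m.+1 -> 'M[R]_m.+1) (x : 'rV[R]_m.+1) : R :=
  let h : 'M[R]_m := row' ord0 (col' ord0 (G x)) in
  \tr (invmx h *m second_fundamental_form G x).

(* The iterated integral over R^m; by Tonelli it is the Lebesgue integral for
   nonnegative Borel functions, and it is only used for those. *)
Fixpoint iterated_integral (R : realType) (m : nat) :
    ('rV[R]_m -> \bar R) -> \bar R :=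
  match m with
  | 0 => fun f => f 0
  | m'.+1 => fun f => (\int[@lebesgue_measure R]_t
      iterated_integral (fun v : 'rV[R]_m' => f (row_mx (t%:M : 'M[R]_1) v)))%E
  end.

Definition coord_volume (R : realType) (m : nat) (G : 'rV[R]_m -> 'M[R]_m)
    (A : set 'rV[R]_m) : \bar R :=
  iterated_integral (fun x => (\1_A x * Num.sqrt (\det (G x)))%:E).

(** * Compact manifolds with (possibly empty) boundary

    Second countability follows from compactness. Tensors are evaluated at a
    point in the chart [chart_at]; by the compatibility conditions the scalar
    quantities below do not depend on this choice. *)

Record compact_manifold (R : realType) (m : nat) := CompactManifold {
  carrier :> topologicalType;
  manifold_hausdorff : hausdorff_space carrier;
  manifold_compact : compact [set: carrier];
  chart : Type;
  chart_dom : chart -> set carrier;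
  chart_map : chart -> carrier -> 'rV[R]_m;
  chart_inv : chart -> 'rV[R]_m -> carrier;
  chart_at : carrier -> chart;
  chart_atP : forall p, chart_dom (chart_at p) p;
  chart_dom_open : forall c, open (chart_dom c);
  chart_mapK : forall c p, chart_dom c p -> chart_inv c (chart_map c p) = p;
  chart_map_image : forall c, exists2 V : set 'rV[R]_m,
    open V & chart_map c @` chart_dom c = V `&` @halfspace R m;
  chart_map_continuous : forall c,
    {within chart_dom c, continuous (chart_map c)};
  chart_inv_continuous : forall c,
    {within chart_map c @` chart_dom c, continuous (chart_inv c)};
  transition_smooth : forall c d (k : 'I_m),
    smooth_on [set x | (chart_map c @` chart_dom c) x /\
                       chart_dom d (chart_inv c x)]
      (fun x => chart_map d (chart_inv c x) 0 k)
}.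

Definition chart_img (R : realType) (m : nat) (M : compact_manifold R m)
    (c : chart M) : set 'rV[R]_m :=
  chart_map c @` chart_dom c.

Definition manifold_boundary (R : realType) (m : nat)
    (M : compact_manifold R m) : set M :=
  [set p | exists2 c : chart M, chart_dom c p &
     exists2 i : 'I_m, val i = 0%N & chart_map c p 0 i = 0].
Arguments manifold_boundary {R m} M.

Definition smooth_function (R : realType) (m : nat) (M : compact_manifold R m)
    (f : M -> R) : Prop :=
  forall c : chart M, smooth_on (chart_img c) (fun x => f (chart_inv c x)).

Definition smooth_map (R : realType) (m n : nat) (M : compact_manifold R m)
    (N : compact_manifold R n) (f : M -> N) : Prop :=
  continuous f /\
  forall (c : chart M) (d : chart N) (k : 'I_n),
    smooth_on [set x | chart_img c x /\ chart_dom d (f (chart_inv c x))]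
      (fun x => chart_map d (f (chart_inv c x)) 0 k).

(** * Riemannian metrics *)

Record riemannian_metric (R : realType) (m : nat) (M : compact_manifold R m) :=
  RiemannianMetric {
  gram :> chart M -> 'rV[R]_m -> 'M[R]_m;
  gram_smooth : forall c i j, smooth_on (chart_img c) (fun x => gram c x i j);
  gram_sym : forall c x, chart_img c x -> (gram c x)^T = gram c x;
  gram_posdef : forall c x (v : 'rV[R]_m), chart_img c x -> v != 0 ->
    0 < (v *m gram c x *m v^T) 0 0;
  gram_transition : forall c d x, chart_img c x ->
    chart_dom d (chart_inv c x) ->
    let tau := fun y => chart_map d (chart_inv c y) in
    gram c x = jacobian tau x *m gram d (tau x) *m (jacobian tau x)^T
}.

Definition scalar_curvature (R : realType) (m : nat)
    (M : compact_manifold R m) (g : riemannian_metric M) (p : M) : R :=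
  coord_scalar_curvature (g (chart_at p)) (chart_map (chart_at p) p).

Definition laplace_beltrami (R : realType) (m : nat)
    (M : compact_manifold R m) (g : riemannian_metric M) (u : M -> R) (p : M) :
    R :=
  coord_laplacian (g (chart_at p)) (fun x => u (chart_inv (chart_at p) x))
    (chart_map (chart_at p) p).

(* Mean curvature of the boundary; only meaningful for [p] in
   [manifold_boundary M]. *)
Definition mean_curvature (R : realType) (m : nat)
    (M : compact_manifold R m.+1) (g : riemannian_metric M) (p : M) : R :=
  coord_mean_curvature (g (chart_at p)) (chart_map (chart_at p) p).

Definition isometric_embedding (R : realType) (m n : nat)
    (M : compact_manifold R m) (g : riemannian_metric M)
    (N : compact_manifold R n) (h : riemannian_metric N) (f : M -> N) : Prop :=
  [/\ injective f, smooth_map f &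
    forall (c : chart M) (d : chart N) x,
      chart_img c x -> chart_dom d (f (chart_inv c x)) ->
      let F := fun y => chart_map d (f (chart_inv c y)) in
      g c x = jacobian F x *m h d (F x) *m (jacobian F x)^T].

(* Volume of the union of the chart domains in [s], minus [A]. *)
Fixpoint charts_volume (R : realType) (m : nat) (M : compact_manifold R m)
    (g : riemannian_metric M) (A : set M) (s : seq (chart M)) : \bar R :=
  match s with
  | [::] => 0%E
  | c :: s' => (coord_volume (g c) (chart_map c @` (chart_dom c `\` A))
                + charts_volume g (A `|` chart_dom c) s')%E
  end.

Definition volume (R : realType) (m : nat) (M : compact_manifold R m)
    (g : riemannian_metric M) : \bar R :=
  ereal_sup (range (charts_volume g set0)).

(* Volume of the unit round sphere S^m: stereographic projection covers all of
   it but a point, and the round metric is (2 / (1 + |x|^2))^2 |dx|^2 there. *)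
Definition sphere_volume (R : realType) (m : nat) : R :=
  fine (coord_volume
    (fun x : 'rV[R]_m => ((2 / (1 + \sum_i x 0 i ^+ 2)) ^+ 2)%:M) setT).

Definition area_radius (R : realType) (m : nat) (M : compact_manifold R m)
    (g : riemannian_metric M) : R :=
  (fine (volume g) / sphere_volume R m) `^ (m%:R^-1).

Definition is_max (R : realType) (T : Type) (f : T -> R) (a : R) : Prop :=
  (exists p, f p = a) /\ (forall p, f p <= a).

(* Main.v *)
Require Import Defs.
From mathcomp Require Import all_boot all_order all_algebra.
From mathcomp Require Import all_classical all_reals all_analysis.
From mathcomp Require Import ring lra.

(** The fill-in is the cylinder Sigma x [0, 1] with a metric
      gamma = A(s) H^-2 ds^2 + rho(s)^2 g,   rho(s) = delta + (1 - delta) s^2.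
    Writing m = n - 1 and eta = 1/H, the scalar curvature of such a metric is
      rho^-2 (R_g - 2 H Delta H^-1) - m H^2 E(s),
    where E only involves A and rho; the lapse 1/H is what makes the
    combination R_g - 2 H Delta H^-1 appear. With beta = - C r_o^2 / (n (n-1))
    and A proportional to rho / (1 + beta rho^2), the slope of rho with respect
    to the arc length dt = sqrt(A) ds satisfies
      (d rho / d t)^2 = const (1 + beta rho^2) (1 - delta / rho),
    a variant of the anti-de Sitter--Schwarzschild profile with its horizon at
    rho = delta. The parameter s, rather than rho, makes the metric smooth up to
    the horizon s = 0, where d rho / d t = 0. Then
      m E <= rho^-2 ((m-1) + (m+1) beta rho^2) / (m (1 - delta) (1 + beta)),
    so that the two strict inequalities of the hypothesis give R_gamma > C as
    soon as delta is small. *)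

Set Implicit Arguments.
Unset Strict Implicit.
Unset Printing Implicit Defensive.

Import Order.TTheory GRing.Theory Num.Theory.
Import numFieldNormedType.Exports.

Local Open Scope classical_set_scope.
Local Open Scope ring_scope.

(** * Partial derivatives and smooth functions on the half-space *)

(** Prescribing the outer mean curvature H forces [a = 4 m^2 (1 - delta)^2 (1 + beta)], so [delta]
    is the only parameter left. A is shaped so that the bound on m H^2 E splits into a multiple of
    rho^-2, to be beaten by rho^-2 (R_g - 2 H Delta H^-1), and a constant, to be kept below -C. With
    q = H^2 / (m (1 - delta) (1 + beta)) this asks for (m - 1) q < R_g - 2 H Delta H^-1 and (m + 1)
    beta q <= -C: one condition for each maximum of the hypothesis, with (1 - delta) (1 + beta) in
    place of 1 + beta. The strictness of the hypothesis is the room for a positive [delta], hence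
    for a horizon.

    Two features of the formal setting shape the rest. Charts take values in a half-space with face
    x_0 = 0, so the two ends of the interval need different charts, and every chart of Sigma is used
    twice. Sigma itself also has half-space charts; since it has no boundary their images lie in x_0
    > 0, where steps are two-sided, so its coordinates can become the unconstrained tangential
    coordinates of the product. *)

Lemma cvg_mx (R : topologicalType) (m n : nat) (T : Type) (F : set_system T) {FF : Filter F}
    (f : T -> 'M[R]_(m, n)) (M : 'M[R]_(m, n)) :
  (forall i j, (fun t => f t i j) @ F --> M i j) -> f @ F --> M.
Proof.
move=> h A [P nP PA].
have : \forall t \near F, forall i j, P i j (f t i j).
  apply: (@filter_forall _ _ (fun i t => forall j, P i j (f t i j)) F) => i.
  apply: (@filter_forall _ _ (fun j t => P i j (f t i j)) F) => j.
  exact/h/nP.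
by apply: filterS => t ht; exact: PA.
Qed.

Section PartialDerivatives.
Variables (R : realType) (m : nat).
Implicit Types (f g : 'rV[R]_m -> R) (x : 'rV[R]_m) (U : set 'rV[R]_m).

(** The calculus rules are proved for this relation, because [partial] is a [lim] and says nothing
    unless a limit exists. *)
Definition is_partial (i : 'I_m) f x (l : R) : Prop :=
  diff_quotient i f x @ admissible_steps i x --> l.

Definition rel_open U : Prop :=
  exists2 V : set 'rV[R]_m, open V & U = V `&` @halfspace R m.

#[global] Instance admissible_steps_filter (i : 'I_m) x :
  Filter (admissible_steps i x).
Proof. exact: within_filter. Qed.

(** Small positive steps never leave the half-space, even from its face. Properness is what makes
    the limits, hence the partial derivatives, unique. *)
Lemma admissible_steps_proper (i : 'I_m) x :
  halfspace x -> ProperFilter (admissible_steps i x).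
Proof.
move=> hx; apply: Build_ProperFilter_ex => A; rewrite /admissible_steps /within /=.
rewrite -nbhs_nearE => /nbhs_ballP[e /= e0 he].
exists (e / 2); apply: he => /=.
- by rewrite /ball /= sub0r normrN gtr0_norm ?divr_gt0// ltr_pdivrMr// ltr_pMr// ltr1n.
- by rewrite gt_eqF// divr_gt0.
- move=> j j0; rewrite !mxE addr_ge0 ?hx// mulr_ge0 ?ler0n// ltW// divr_gt0//.
Qed.

Lemma step_cvg (i : 'I_m) x :
  (fun h => x + h *: delta_mx 0 i) @ admissible_steps i x --> x.
Proof.
have h : (fun h : R => x + h *: delta_mx 0 i) @ (0 : R) --> x.
  apply: (@cvg_mx R 1 m _ (nbhs (0 : R)) _) => k j.
  have -> : (fun h => (x + h *: delta_mx 0 i) k j) =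
            (fun h => x k j + h * (delta_mx 0 i : 'rV[R]_m) k j).
    by apply/funext => h; rewrite !mxE.
  rewrite -[X in _ --> X]addr0 -[X in _ --> _ + X](mul0r ((delta_mx 0 i : 'rV[R]_m) k j)).
  by apply: cvgD; [exact: cvg_cst|apply: cvgM; [exact: cvg_id|exact: cvg_cst]].
apply: cvg_trans h; apply: cvg_app.
apply: cvg_trans; first exact: cvg_within.
exact: cvg_within.
Qed.

Lemma rel_open_steps (i : 'I_m) U x : rel_open U -> U x ->
  \forall h \near admissible_steps i x, U (x + h *: delta_mx 0 i).
Proof.
move=> [V oV ->] [Vx hx].
have hV : \forall h \near admissible_steps i x, V (x + h *: delta_mx 0 i).
  by apply: step_cvg; exact: open_nbhs_nbhs.
have hH : \forall h \near admissible_steps i x, halfspace (x + h *: delta_mx 0 i).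
  rewrite /admissible_steps; rewrite near_withinE; exact: nearW.
by apply: filterS2 hV hH => h.
Qed.

Lemma rel_open_half U x : rel_open U -> U x -> halfspace x.
Proof. by move=> [V _ ->] []. Qed.

Lemma is_partialE (i : 'I_m) f x l : halfspace x -> is_partial i f x l -> partial i f x = l.
Proof.
move=> hx hl; rewrite /partial.
have ? := admissible_steps_proper i hx.
by apply/cvg_lim => //; exact: norm_hausdorff.
Qed.

Lemma is_partial_has (i : 'I_m) f x l : is_partial i f x l -> has_partial i f x.
Proof. by move=> h; apply/cvg_ex; exists l. Qed.

Lemma has_partialP (i : 'I_m) f x : has_partial i f x -> is_partial i f x (partial i f x).
Proof. by []. Qed.

Lemma is_partial_congr U (i : 'I_m) f g x l : rel_open U -> U x ->
  {in U, f =1 g} -> is_partial i f x l -> is_partial i g x l.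
Proof.
move=> oU Ux fg; apply: cvg_trans; apply: near_eq_cvg.
apply: filterS (rel_open_steps i oU Ux) => h Uh.
by rewrite /diff_quotient !fg ?inE.
Qed.

Lemma partial_congr U (i : 'I_m) f g x : rel_open U -> U x ->
  {in U, f =1 g} -> partial i f x = partial i g x.
Proof.
move=> oU Ux fg; rewrite /partial; congr (lim _); apply/seteqP.
have h : \forall h \near admissible_steps i x, diff_quotient i f x h = diff_quotient i g x h.
  apply: filterS (rel_open_steps i oU Ux) => h Uh.
  by rewrite /diff_quotient !fg ?inE.
by split; apply: near_eq_cvg => //; apply: filterS h => t ->.
Qed.

Lemma is_partial_cst (i : 'I_m) (a : R) x : is_partial i (fun=> a) x 0.
Proof.
rewrite /is_partial (_ : diff_quotient _ _ _ = fun=> 0); first exact: cvg_cst.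
by apply/funext => h; rewrite /diff_quotient subrr mulr0.
Qed.

Lemma is_partialD (i : 'I_m) f g x a b : is_partial i f x a -> is_partial i g x b ->
  is_partial i (fun y => f y + g y) x (a + b).
Proof.
move=> fa gb; rewrite /is_partial
  (_ : diff_quotient _ _ _ = diff_quotient i f x + diff_quotient i g x).
  exact: cvgD.
by apply/funext => h; rewrite /diff_quotient fctE -mulrDr; congr (_ * _); ring.
Qed.

(** From [f (x + h e_i) = f x + h * diff_quotient]. Continuity along the one direction concerned is
    all that the product and quotient rules require. *)
Lemma is_partial_step_cvg (i : 'I_m) f x a : is_partial i f x a ->
  (fun h => f (x + h *: delta_mx 0 i)) @ admissible_steps i x --> f x.
Proof.
move=> fa.
have h0 : (fun h : R => h) @ admissible_steps i x --> (0 : R).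
  by apply: cvg_trans; [exact: cvg_within|exact: cvg_within].
have : (fun h => f x + h * diff_quotient i f x h) @ admissible_steps i x --> f x + 0 * a.
  by apply: cvgD; [exact: cvg_cst|apply: cvgM].
rewrite mul0r addr0; apply: cvg_trans; apply: near_eq_cvg.
have hn0 : \forall h \near admissible_steps i x, h != 0.
  rewrite /admissible_steps near_withinE; rewrite near_withinE.
  by apply: nearW.
apply: filterS hn0 => h hn0.
by rewrite /diff_quotient mulrA mulfV// mul1r addrC subrK.
Qed.

Lemma is_partialM (i : 'I_m) f g x a b : is_partial i f x a -> is_partial i g x b ->
  is_partial i (fun y => f y * g y) x (a * g x + f x * b).
Proof.
move=> fa gb; rewrite /is_partial
  (_ : diff_quotient _ _ _ = (fun h => diff_quotient i f x h * g x +
    f (x + h *: delta_mx 0 i) * diff_quotient i g x h)).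
  apply: cvgD; apply: cvgM => //; [exact: cvg_cst|exact: is_partial_step_cvg fa].
apply/funext => h; rewrite /diff_quotient; ring.
Qed.

Lemma is_partialN (i : 'I_m) f x a : is_partial i f x a ->
  is_partial i (fun y => - f y) x (- a).
Proof.
move=> fa; rewrite /is_partial (_ : diff_quotient _ _ _ = - diff_quotient i f x).
  exact: cvgN.
by apply/funext => h; rewrite /diff_quotient fctE; ring.
Qed.

Lemma is_partialB (i : 'I_m) f g x a b : is_partial i f x a -> is_partial i g x b ->
  is_partial i (fun y => f y - g y) x (a - b).
Proof. by move=> fa gb; apply: is_partialD => //; exact: is_partialN. Qed.

Lemma is_partialZ (i : 'I_m) f x a (c : R) : is_partial i f x a ->
  is_partial i (fun y => c * f y) x (c * a).
Proof.
move=> fa; have := is_partialM (is_partial_cst i c x) fa.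
by rewrite mul0r add0r.
Qed.

Lemma is_partialV (i : 'I_m) f x a : f x != 0 -> is_partial i f x a ->
  is_partial i (fun y => (f y)^-1) x (- a / f x ^+ 2).
Proof.
move=> fx0 fa; have fc := is_partial_step_cvg fa.
have : (fun h => - diff_quotient i f x h * ((f (x + h *: delta_mx 0 i))^-1 * (f x)^-1))
   @ admissible_steps i x --> - a * ((f x)^-1 * (f x)^-1).
  apply: cvgM; first exact: cvgN.
  apply: cvgM; last exact: cvg_cst.
  exact: (cvgV fx0 fc).
rewrite expr2 invfM; apply: cvg_trans; apply: near_eq_cvg.
have h0 : \forall h \near admissible_steps i x, f (x + h *: delta_mx 0 i) != 0.
  exact: cvgr_neq0 fc fx0.
apply: filterS h0 => h fh; rewrite /diff_quotient.
set u := f _ in fh *; set v := f x in fx0 *.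
rewrite -mulrN -mulrA; congr (_ * _); field.
by rewrite fh fx0.
Qed.

Lemma is_partial_sum (i : 'I_m) (I : Type) (r : seq I) (F : I -> 'rV[R]_m -> R) (a : I -> R) x :
  (forall j, is_partial i (F j) x (a j)) ->
  is_partial i (fun y => \sum_(j <- r) F j y) x (\sum_(j <- r) a j).
Proof.
move=> h; elim: r => [|j r ih].
  rewrite big_nil (_ : (fun _ => _) = fun=> 0); first exact: is_partial_cst.
  by apply/funext => y; rewrite big_nil.
rewrite big_cons (_ : (fun _ => _) = fun y => F j y + \sum_(j <- r) F j y).
  by apply: is_partialD.
by apply/funext => y; rewrite big_cons.
Qed.

Lemma is_partial_coord (i j : 'I_m) x : halfspace x ->
  is_partial i (fun y => y 0 j) x (i == j)%:R.
Proof.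
move=> hx; rewrite /is_partial.
have hn0 : \forall h \near admissible_steps i x, h != 0.
  rewrite /admissible_steps near_withinE; rewrite near_withinE.
  by apply: nearW.
have : (fun=> (i == j)%:R : R) @ admissible_steps i x --> ((i == j)%:R : R).
  exact: cvg_cst.
apply: cvg_trans; apply: near_eq_cvg; apply: filterS hn0 => h h0.
by rewrite /diff_quotient !mxE /= eq_sym [j == i]eq_sym (addrC (x 0 j)) addrK mulrA mulVf// mul1r.
Qed.

(** Finite-order counterpart of [smooth_on], recursive in the order: a derivative of a product is a
    sum of products of functions known to one order less, so closure proofs go by induction on [k]
    rather than on a word of derivatives. *)
Fixpoint cont_diff (k : nat) U f : Prop :=
  {within U, continuous f} /\
  if k is k'.+1 then
    (forall (i : 'I_m) x, U x -> has_partial i f x) /\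
    (forall i : 'I_m, cont_diff k' U (partial i f))
  else True.

Lemma cont_diff_continuous k U f : cont_diff k U f -> {within U, continuous f}.
Proof. by case: k => [|k] []. Qed.

Lemma cont_diffW k U f : cont_diff k.+1 U f -> cont_diff k U f.
Proof.
elim: k f => [|k ih] f [cf [pf Df]]; first by [].
by split=> //; split=> // i; apply: ih; exact: Df.
Qed.

Lemma smooth_onP U f : smooth_on U f <-> forall k, cont_diff k U f.
Proof.
split=> [sf k|h s].
  elim: k f sf => [|k ih] f sf /=; first by have [] := sf [::].
  split; first by have [] := sf [::].
  split; first by have [] := sf [::].
  (* In [foldr] the last letter of the word acts first, so appending [i] differentiates [f]
     itself. *)
  move=> i; apply: ih => s; have := sf (rcons s i).
  by rewrite foldr_rcons.
elim/last_ind: s f h => [|s i ih] f h /=.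
  have [cf [pf _]] := h 1%N; by split.
have := ih (partial i f); rewrite foldr_rcons; apply => k.
by have [_ [_]] := h k.+1; apply.
Qed.

Lemma smooth_on_has_partial U f (i : 'I_m) x : smooth_on U f -> U x -> has_partial i f x.
Proof. by move=> /(_ [::]) [_ h] /h. Qed.

Lemma smooth_on_partial U f (i : 'I_m) : smooth_on U f -> smooth_on U (partial i f).
Proof. by move=> sf s; have := sf (rcons s i); rewrite foldr_rcons. Qed.

Lemma smooth_onW U U' f : U' `<=` U -> smooth_on U f -> smooth_on U' f.
Proof.
move=> UU' sf s; have [cf pf] := sf s; split; first exact: continuous_subspaceW cf.
by move=> i x /UU'; exact: pf.
Qed.

Lemma cont_diff_congr k U f g : rel_open U -> {in U, f =1 g} ->
  cont_diff k U f -> cont_diff k U g.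
Proof.
move=> oU; elim: k f g => [|k ih] f g fg [cf pf].
  by split=> //; exact: subspace_eq_continuous cf.
split; first exact: subspace_eq_continuous cf.
case: pf => pf Df; split.
  by move=> i x Ux; apply/is_partial_has/(is_partial_congr oU Ux fg)/has_partialP/pf.
move=> i; apply: ih (Df i) => x; rewrite inE => Ux; exact: partial_congr Ux fg.
Qed.

Lemma cont_diff_cst k U (a : R) : rel_open U -> cont_diff k U (fun=> a).
Proof.
move=> oU; elim: k a => [|k ih] a; first by split=> // x; exact: cvg_cst.
split; first by move=> x; exact: cvg_cst.
split=> [i x _|i]; first exact/is_partial_has/is_partial_cst.
apply: cont_diff_congr (ih 0) => // x; rewrite inE => /(rel_open_half oU) hx.
by rewrite (is_partialE hx (is_partial_cst i a x)).
Qed.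

Lemma cont_diffD k U f g : rel_open U -> cont_diff k U f -> cont_diff k U g ->
  cont_diff k U (fun x => f x + g x).
Proof.
move=> oU; elim: k f g => [|k ih] f g [cf pf] [cg pg].
  by split=> // x; apply: cvgD; [exact: cf|exact: cg].
split; first by move=> x; apply: cvgD; [exact: cf|exact: cg].
case: pf pg => pf Df [pg Dg]; split=> [i x Ux|i].
  by apply/is_partial_has/is_partialD; apply/has_partialP; [exact: pf|exact: pg].
apply: cont_diff_congr (ih _ _ (Df i) (Dg i)) => // x; rewrite inE => Ux.
apply/esym/is_partialE; first exact: rel_open_half Ux.
by apply/is_partialD; apply/has_partialP; [exact: pf|exact: pg].
Qed.

Lemma cont_diffM k U f g : rel_open U -> cont_diff k U f -> cont_diff k U g ->
  cont_diff k U (fun x => f x * g x).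
Proof.
move=> oU; elim: k f g => [|k ih] f g sf sg.
  split=> // x; apply: cvgM; [exact: (cont_diff_continuous sf)|exact: (cont_diff_continuous sg)].
split; first by move=> x; apply: cvgM; [exact: (cont_diff_continuous sf)|exact: (cont_diff_continuous sg)].
have [_ [pf Df]] := sf; have [_ [pg Dg]] := sg.
have hp i x : U x -> is_partial i (fun x => f x * g x) x
    (partial i f x * g x + f x * partial i g x).
  by move=> Ux; apply: is_partialM; apply/has_partialP; [exact: pf|exact: pg].
split=> [i x Ux|i]; first exact/is_partial_has/hp.
have := cont_diffD oU (ih _ _ (Df i) (cont_diffW sg)) (ih _ _ (cont_diffW sf) (Dg i)).
apply: cont_diff_congr => // x; rewrite inE => Ux.
by rewrite (is_partialE (rel_open_half oU Ux) (hp i x Ux)).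
Qed.

(** The derivative of 1/f is - f' (1/f)^2, in which 1/f occurs at one order less, so the induction
    closes. *)
Lemma cont_diffV k U f : rel_open U -> (forall x, U x -> f x != 0) ->
  cont_diff k U f -> cont_diff k U (fun x => (f x)^-1).
Proof.
move=> oU f0; elim: k => [|k ih] sf; have cf := cont_diff_continuous sf.
  split=> //; apply/subspace_continuousP => x Ux.
  by apply: cvgV; [exact: f0|move/subspace_continuousP: cf; exact].
split.
  apply/subspace_continuousP => x Ux.
  by apply: cvgV; [exact: f0|move/subspace_continuousP: cf; exact].
have [_ [pf Df]] := sf.
have hp i x : U x -> is_partial i (fun x => (f x)^-1) x (- partial i f x / f x ^+ 2).
  by move=> Ux; apply: is_partialV; [exact: f0|apply/has_partialP; exact: pf].
split=> [i x Ux|i]; first exact/is_partial_has/hp.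
have si := ih (cont_diffW sf).
have := cont_diffM oU (cont_diff_cst k (-1) oU) (cont_diffM oU (Df i) (cont_diffM oU si si)).
apply: cont_diff_congr => // x; rewrite inE => Ux.
by rewrite (is_partialE (rel_open_half oU Ux) (hp i x Ux)) expr2 invfM mulN1r mulNr.
Qed.

Lemma smooth_on_congr U f g : rel_open U -> {in U, f =1 g} ->
  smooth_on U f -> smooth_on U g.
Proof. by move=> oU fg /smooth_onP sf; apply/smooth_onP => k; exact: cont_diff_congr fg _. Qed.

Lemma smooth_on_cst U (a : R) : rel_open U -> smooth_on U (fun=> a).
Proof. by move=> oU; apply/smooth_onP => k; exact: cont_diff_cst. Qed.

Lemma smooth_onD U f g : rel_open U -> smooth_on U f -> smooth_on U g ->
  smooth_on U (fun x => f x + g x).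
Proof. by move=> oU /smooth_onP sf /smooth_onP sg; apply/smooth_onP => k; exact: cont_diffD. Qed.

Lemma smooth_onM U f g : rel_open U -> smooth_on U f -> smooth_on U g ->
  smooth_on U (fun x => f x * g x).
Proof. by move=> oU /smooth_onP sf /smooth_onP sg; apply/smooth_onP => k; exact: cont_diffM. Qed.

Lemma smooth_onV U f : rel_open U -> (forall x, U x -> f x != 0) -> smooth_on U f ->
  smooth_on U (fun x => (f x)^-1).
Proof. by move=> oU f0 /smooth_onP sf; apply/smooth_onP => k; exact: cont_diffV. Qed.

Lemma smooth_onZ U f (a : R) : rel_open U -> smooth_on U f -> smooth_on U (fun x => a * f x).
Proof. by move=> oU sf; apply: smooth_onM => //; exact: smooth_on_cst. Qed.

Lemma smooth_onB U f g : rel_open U -> smooth_on U f -> smooth_on U g ->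
  smooth_on U (fun x => f x - g x).
Proof.
move=> oU sf sg; apply: smooth_on_congr (smooth_onD oU sf (smooth_onZ (-1) oU sg)) => // x _.
by rewrite mulN1r.
Qed.

Lemma smooth_on_sum U (I : Type) (r : seq I) (F : I -> 'rV[R]_m -> R) : rel_open U ->
  (forall j, smooth_on U (F j)) -> smooth_on U (fun x => \sum_(j <- r) F j x).
Proof.
move=> oU sF; elim: r => [|j r ih].
  by apply: smooth_on_congr (smooth_on_cst 0 oU) => // x _; rewrite big_nil.
by apply: smooth_on_congr (smooth_onD oU (sF j) ih) => // x _; rewrite big_cons.
Qed.

Lemma smooth_on_prod U (I : Type) (r : seq I) (F : I -> 'rV[R]_m -> R) : rel_open U ->
  (forall j, smooth_on U (F j)) -> smooth_on U (fun x => \prod_(j <- r) F j x).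
Proof.
move=> oU sF; elim: r => [|j r ih].
  by apply: smooth_on_congr (smooth_on_cst 1 oU) => // x _; rewrite big_nil.
by apply: smooth_on_congr (smooth_onM oU (sF j) ih) => // x _; rewrite big_cons.
Qed.

Lemma smooth_on_coord U (j : 'I_m) : rel_open U -> smooth_on U (fun x => x 0 j).
Proof.
move=> oU; apply/smooth_onP; case=> [|k].
  by split=> //; apply: continuous_subspaceT => x; exact: coord_continuous.
split; first by apply: continuous_subspaceT => x; exact: coord_continuous.
split=> [i x Ux|i].
  by apply/is_partial_has/is_partial_coord; exact: rel_open_half Ux.
apply: cont_diff_congr (cont_diff_cst k (i == j)%:R oU) => // x; rewrite inE => Ux.
by have hx := rel_open_half oU Ux; rewrite (is_partialE hx (is_partial_coord hx)).
Qed.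

End PartialDerivatives.

Section SmoothMatrices.
Variables (R : realType) (m n : nat) (U : set 'rV[R]_m) (oU : rel_open U).

Lemma smooth_on_det (F : 'rV[R]_m -> 'M[R]_n) :
  (forall i j, smooth_on U (fun x => F x i j)) -> smooth_on U (fun x => \det (F x)).
Proof.
move=> sF; apply: smooth_on_sum => // s; apply: smooth_onM => //.
  exact: smooth_on_cst.
exact: smooth_on_prod.
Qed.

End SmoothMatrices.

(** Cramer's rule: the entries of the inverse are cofactors divided by a nonvanishing
    determinant. *)
Lemma smooth_on_invmx (R : realType) (m n : nat) (U : set 'rV[R]_m) (F : 'rV[R]_m -> 'M[R]_n) :
  rel_open U -> (forall x, U x -> F x \in unitmx) ->
  (forall i j, smooth_on U (fun x => F x i j)) ->
  forall i j, smooth_on U (fun x => invmx (F x) i j).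
Proof.
move=> oU uF sF i j.
have : smooth_on U (fun x => (\det (F x))^-1 * ((-1) ^+ (j + i) * \det (row' j (col' i (F x))))).
  apply: smooth_onM => //.
    apply: smooth_onV => //; last exact: smooth_on_det.
    by move=> x /uF; rewrite unitmxE unitfE.
  apply: smooth_onZ => //; apply: smooth_on_det => // k l.
  by apply: smooth_on_congr (sF (lift j k) (lift i l)) => // x _; rewrite !mxE.
apply: smooth_on_congr => // x; rewrite inE => /uF ux.
by rewrite /invmx ux !mxE.
Qed.

(** * Splitting off the first coordinate *)

Section HeadTail.
Variables (R : realType) (m : nat).
Implicit Types (x : 'rV[R]_m) (y : 'rV[R]_m.+1).

Definition rv_cons (u : R) x : 'rV[R]_m.+1 := \row_i oapp (x 0) u (unlift ord0 i).

Definition rv_tail y : 'rV[R]_m := \row_j y 0 (lift ord0 j).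

Lemma rv_cons0 u x : rv_cons u x 0 ord0 = u.
Proof. by rewrite mxE unlift_none. Qed.

Lemma rv_consS u x j : rv_cons u x 0 (lift ord0 j) = x 0 j.
Proof. by rewrite mxE liftK. Qed.

Lemma rv_consK u x : rv_tail (rv_cons u x) = x.
Proof. by apply/rowP => j; rewrite mxE rv_consS. Qed.

Lemma rv_tailK y : rv_cons (y 0 ord0) (rv_tail y) = y.
Proof.
apply/rowP => i; case: (unliftP ord0 i) => [j|] ->; last by rewrite rv_cons0.
by rewrite rv_consS mxE.
Qed.

Lemma rv_tail_step0 y (h : R) : rv_tail (y + h *: delta_mx 0 ord0) = rv_tail y.
Proof. by apply/rowP => j; rewrite !mxE /= mulr0 addr0. Qed.

Lemma rv_tail_stepS y (h : R) i :
  rv_tail (y + h *: delta_mx 0 (lift ord0 i)) = rv_tail y + h *: delta_mx 0 i.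
Proof. by apply/rowP => j; rewrite !mxE /= (inj_eq (@lift_inj _ ord0)). Qed.

Lemma rv_tail_continuous : continuous rv_tail.
Proof.
move=> y; apply: (@cvg_mx R 1 m _ (nbhs y) (nbhs_filter y)) => i j; rewrite ord1 mxE.
rewrite (_ : (fun t => _) = (fun t : 'rV[R]_m.+1 => t 0 (lift ord0 j))).
  exact: coord_continuous.
by apply/funext => t; rewrite mxE.
Qed.

Definition open_halfspace : set 'rV[R]_m := [set x | forall i : 'I_m, val i = 0%N -> 0 < x 0 i].

Lemma admissible_stepsE (n : nat) (i : 'I_n) (z : 'rV[R]_n) :
  (\forall h \near (0 : R), halfspace (z + h *: delta_mx 0 i)) ->
  admissible_steps i z = (0 : R)^'.
Proof.
move=> near_half; rewrite /admissible_steps; apply/seteqP; split => A.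
  have nh : \forall h \near (0 : R)^', halfspace (z + h *: delta_mx 0 i).
    by move: near_half; exact: cvg_within.
  by rewrite /within /= => hA; apply: filterS2 nh hA => h hz; apply.
by rewrite /within /=; apply: filterS => h Ah _.
Qed.

(** The two sides refer to different half-spaces: the first coordinate of [rv_tail y] is constrained
    on the right but not on the left. They agree because the tail is an interior point, so both
    filters are the full punctured neighbourhoods of 0. *)
Lemma admissible_steps_lift (i : 'I_m) y : 0 <= y 0 ord0 -> open_halfspace (rv_tail y) ->
  admissible_steps (lift ord0 i) y = admissible_steps i (rv_tail y).
Proof.
move=> y0 ty; rewrite !admissible_stepsE//.
  apply: (@filter_forall _ _ (fun j h => val j = 0%N -> 0 <= (rv_tail y + h *: delta_mx 0 i) 0 j) (nbhs (0 : R))) => j.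
  have [j0|j0] := eqVneq (val j) 0%N; last first.
    by apply: nearW => h hj; rewrite hj in j0.
  have : (fun h => (rv_tail y) 0 j + h * (delta_mx 0 i : 'rV[R]_m) 0 j) @ (0 : R) --> (rv_tail y) 0 j.
    rewrite -[X in _ --> X]addr0 -[X in _ --> _ + X](mul0r ((delta_mx 0 i : 'rV[R]_m) 0 j)).
    by apply: cvgD; [exact: cvg_cst|apply: cvgM; [exact: cvg_id|exact: cvg_cst]].
  move/cvgr_ge => /(_ 0 (ty j j0)); apply: filterS => h hh _.
  by rewrite [X in 0 <= X]mxE [X in 0 <= _ + X]mxE.
apply: filterE => h k k0.
have -> : k = ord0 by apply: val_inj.
by rewrite !mxE /= mulr0 addr0.
Qed.

Lemma is_partial_tail (f : 'rV[R]_m -> R) (i : 'I_m) y l :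
  0 <= y 0 ord0 -> open_halfspace (rv_tail y) ->
  is_partial i f (rv_tail y) l -> is_partial (lift ord0 i) (fun y => f (rv_tail y)) y l.
Proof.
move=> y0 ty; rewrite /is_partial admissible_steps_lift//.
rewrite (_ : diff_quotient _ _ _ = diff_quotient i f (rv_tail y))//.
by apply/funext => h; rewrite /diff_quotient rv_tail_stepS.
Qed.

Lemma is_partial_tail0 (f : 'rV[R]_m -> R) y :
  is_partial ord0 (fun y => f (rv_tail y)) y 0.
Proof.
rewrite /is_partial (_ : diff_quotient _ _ _ = fun=> 0); first exact: cvg_cst.
by apply/funext => h; rewrite /diff_quotient rv_tail_step0 subrr mulr0.
Qed.

Lemma is_partial_head (A : R -> R) (i : 'I_m) y :
  is_partial (lift ord0 i) (fun y => A (y 0 ord0)) y 0.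
Proof.
rewrite /is_partial (_ : diff_quotient _ _ _ = fun=> 0); first exact: cvg_cst.
by apply/funext => h; rewrite /diff_quotient !mxE /= mulr0 addr0 subrr mulr0.
Qed.

Lemma partial_tail (f : 'rV[R]_m -> R) (i : 'I_m) y :
  0 <= y 0 ord0 -> open_halfspace (rv_tail y) ->
  partial (lift ord0 i) (fun y => f (rv_tail y)) y = partial i f (rv_tail y).
Proof.
move=> y0 ty; rewrite /partial admissible_steps_lift//.
rewrite (_ : diff_quotient _ _ _ = diff_quotient i f (rv_tail y))//.
by apply/funext => h; rewrite /diff_quotient rv_tail_stepS.
Qed.

(* The domain of a product chart of [0, 1[ x S. *)
Definition cylinder (S : set 'rV[R]_m) : set 'rV[R]_m.+1 :=
  [set y : 'rV[R]_m.+1 | 0 <= y 0 ord0 < 1 /\ S (rv_tail y)].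

Lemma rel_open_open (S : set 'rV[R]_m) : open S -> S `<=` open_halfspace -> rel_open S.
Proof.
move=> oS SP; exists S => //; apply/seteqP; split=> x; last by case.
by move=> Sx; split=> // i /(SP _ Sx) /ltW.
Qed.

Lemma rel_open_cylinder (S : set 'rV[R]_m) : open S -> rel_open (cylinder S).
Proof.
move=> oS; exists ([set y : 'rV[R]_m.+1 | y 0 ord0 < 1] `&` rv_tail @^-1` S).
  apply: openI.
    apply: (@open_comp _ _ (fun y : 'rV[R]_m.+1 => y 0 ord0) [set u : R | u < 1]); last exact: open_lt.
    by move=> y _; exact: coord_continuous.
  by apply: open_comp => // y _; exact: rv_tail_continuous.
apply/seteqP; split=> y.
  move=> [/andP[y0 y1] Sy]; split=> // i i0.
  by have -> : i = ord0 by apply: val_inj.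
by move=> [[/= y1 Sy] hy]; split=> //; rewrite y1 hy.
Qed.

Lemma smooth_on_tail (S : set 'rV[R]_m) (f : 'rV[R]_m -> R) :
  open S -> S `<=` open_halfspace -> smooth_on S f ->
  smooth_on (cylinder S) (fun y => f (rv_tail y)).
Proof.
move=> oS SP /smooth_onP sf; apply/smooth_onP => k.
have oC := rel_open_cylinder oS.
have ct (h : 'rV[R]_m -> R) : {within S, continuous h} ->
    {within cylinder S, continuous (fun y => h (rv_tail y))}.
  move=> /subspace_continuousP ch; apply/subspace_continuousP => y [_ Sy].
  have ctail : rv_tail @ within (cylinder S) (nbhs y) --> within S (nbhs (rv_tail y)).
    move=> B; rewrite /within /= => hB.
    have hz : \forall z \near y, S (rv_tail z) -> B (rv_tail z).
      exact: (rv_tail_continuous hB).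
    change (\forall z \near y, cylinder S z -> B (rv_tail z)).
    by apply: filterS hz => z hz [_]; exact: hz.
  exact: (cvg_comp _ _ ctail (ch _ Sy)).
elim: k f sf => [|k ih] f sf; have cf := ct _ (cont_diff_continuous (sf 0%N)).
  by split.
split=> //; split.
  move=> i y [/andP[y0 _] Sy]; case: (unliftP ord0 i) => [j|] ->; last first.
    exact: is_partial_has (is_partial_tail0 f y).
  apply: is_partial_has (is_partial_tail y0 (SP _ Sy) _).
  by apply/has_partialP; have [_ [pf _]] := sf 1%N; exact: pf.
move=> i; case: (unliftP ord0 i) => [j|] ->; last first.
  apply: cont_diff_congr (cont_diff_cst k 0 oC) => // y; rewrite inE => Cy.
  by rewrite (is_partialE (rel_open_half oC Cy) (is_partial_tail0 f y)).
apply: cont_diff_congr (ih (partial j f) _) => //.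
  move=> y; rewrite inE => -[/andP[y0 _] Sy].
  by rewrite partial_tail//; exact: SP.
by move=> k'; have [_ [_]] := sf k'.+1; apply.
Qed.

End HeadTail.

Arguments open_halfspace {R m}.

(** * Block diagonal matrices with a scalar first block *)

Section Diag1.
Variables (R : comUnitRingType) (m : nat).

(** Written with [unlift ord0] so that it evaluates on [ord0] and [lift ord0 j], the indices
    produced by [big_ord_recl]. *)
Definition diag1_mx (a : R) (M : 'M[R]_m) : 'M[R]_m.+1 :=
  \matrix_(i, j) match unlift ord0 i, unlift ord0 j with
    | None, None => a
    | Some i', Some j' => M i' j'
    | _, _ => 0
    end.

Lemma diag1_mx00 a M : diag1_mx a M ord0 ord0 = a.
Proof. by rewrite mxE unlift_none. Qed.

Lemma diag1_mx0S a M j : diag1_mx a M ord0 (lift ord0 j) = 0.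
Proof. by rewrite mxE unlift_none liftK. Qed.

Lemma diag1_mxS0 a M i : diag1_mx a M (lift ord0 i) ord0 = 0.
Proof. by rewrite mxE unlift_none liftK. Qed.

Lemma diag1_mxSS a M i j : diag1_mx a M (lift ord0 i) (lift ord0 j) = M i j.
Proof. by rewrite mxE !liftK. Qed.

Definition diag1_mxE := (diag1_mx00, diag1_mx0S, diag1_mxS0, diag1_mxSS).

Lemma diag1_mxM a b M N : diag1_mx a M *m diag1_mx b N = diag1_mx (a * b) (M *m N).
Proof.
apply/matrixP => i j; rewrite mxE big_ord_recl.
case: (unliftP ord0 i) => [i'|] ->; case: (unliftP ord0 j) => [j'|] ->;
  rewrite !diag1_mxE ?mulr0 ?mul0r ?add0r.
- by rewrite mxE; apply: eq_bigr => k _; rewrite !diag1_mxE.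
- by rewrite big1// => k _; rewrite !diag1_mxE mulr0.
- by rewrite big1// => k _; rewrite !diag1_mxE mul0r.
- by rewrite big1 ?addr0// => k _; rewrite !diag1_mxE mulr0.
Qed.

Lemma diag1_mx1 : diag1_mx 1 1%:M = 1%:M.
Proof.
apply/matrixP => i j; case: (unliftP ord0 i) => [i'|] ->;
  case: (unliftP ord0 j) => [j'|] ->; rewrite !diag1_mxE !mxE //=.
Qed.

Lemma diag1_mx_tr a M : (diag1_mx a M)^T = diag1_mx a M^T.
Proof.
apply/matrixP => i j; rewrite mxE; case: (unliftP ord0 i) => [i'|] ->;
  case: (unliftP ord0 j) => [j'|] ->; by rewrite !diag1_mxE ?mxE.
Qed.

Lemma invmx_diag1 a M : a \is a GRing.unit -> M \in unitmx ->
  invmx (diag1_mx a M) = diag1_mx a^-1 (invmx M).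
Proof.
move=> ua uM.
have h : diag1_mx a M *m diag1_mx a^-1 (invmx M) = 1%:M.
  by rewrite diag1_mxM divrr// mulmxV// diag1_mx1.
have [uD _] := mulmx1_unit h.
by rewrite -[RHS](mulKmx uD) h mulmx1.
Qed.

End Diag1.

(** * Curvature of warped metrics in coordinates *)

Lemma is_partial_eq (R : realType) (m : nat) (i : 'I_m) (f : 'rV[R]_m -> R) x l l' :
  l = l' -> is_partial i f x l -> is_partial i f x l'.
Proof. by move=> ->. Qed.

(** * The Laplacian of a coordinate metric as a divergence *)

Section CoordinateMetric.
Variables (R : realType) (m : nat) (S : set 'rV[R]_m) (oS : rel_open S).
Variable g : 'rV[R]_m -> 'M[R]_m.
Hypothesis sg : forall i j, smooth_on S (fun x => g x i j).
Hypothesis gT : forall x, S x -> (g x)^T = g x.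
Hypothesis gu : forall x, S x -> g x \in unitmx.

Lemma gram_entry_sym x i j : S x -> g x i j = g x j i.
Proof. by move=> /gT gx; rewrite -[in LHS]gx mxE. Qed.

Lemma invmx_gram_sym x i j : S x -> invmx (g x) i j = invmx (g x) j i.
Proof. by move=> Sx; rewrite -[in RHS](gT Sx) -trmx_inv mxE. Qed.

Lemma partial_gram_sym l x i j : S x ->
  partial l (fun z => g z i j) x = partial l (fun z => g z j i) x.
Proof.
move=> Sx; apply: (partial_congr l oS Sx) => z; rewrite inE.
exact: gram_entry_sym.
Qed.

Lemma christoffel_sym k i j x : S x -> christoffel g k i j x = christoffel g k j i x.
Proof.
move=> Sx; rewrite /christoffel; congr (_ * _); apply: eq_bigr => l _.
by rewrite (partial_gram_sym l i j Sx) [X in X - _]addrC.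
Qed.

Lemma smooth_on_invgram i j : smooth_on S (fun x => invmx (g x) i j).
Proof. exact: smooth_on_invmx. Qed.

Lemma sum_invgramK x i j : S x -> \sum_k invmx (g x) i k * g x j k = (i == j)%:R.
Proof.
move=> Sx; have := mulVmx (gu Sx) => /matrixP/(_ i j); rewrite !mxE => <-.
by apply: eq_bigr => k _; rewrite (gram_entry_sym j k Sx).
Qed.

(** Differentiate [invmx g *m g = 1] entrywise, then multiply by [invmx g] on the right. *)
Lemma partial_invgram k i j x : S x ->
  partial k (fun z => invmx (g z) i j) x =
  - \sum_p \sum_q invmx (g x) i p * partial k (fun z => g z p q) x * invmx (g x) q j.
Proof.
move=> Sx; have hx := rel_open_half oS Sx.
pose d a b := partial k (fun z => invmx (g z) a b) x.
have dP a b : is_partial k (fun z => invmx (g z) a b) x (d a b).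
  by apply/has_partialP; exact: smooth_on_has_partial (smooth_on_invgram a b) Sx.
have gP a b : is_partial k (fun z => g z a b) x (partial k (fun z => g z a b) x).
  by apply/has_partialP; exact: smooth_on_has_partial (sg a b) Sx.
have key q : \sum_p (d i p * g x p q + invmx (g x) i p * partial k (fun z => g z p q) x) = 0.
  have h1 := is_partial_sum (r := index_enum 'I_m) (fun p => is_partialM (dP i p) (gP p q)).
  have h2 : is_partial k (fun z => \sum_p invmx (g z) i p * g z p q) x 0.
    apply: (is_partial_congr oS Sx _ (is_partial_cst k ((i == q)%:R) x)) => z.
    by rewrite inE => Sz; have := mulVmx (gu Sz) => /matrixP/(_ i q); rewrite !mxE.
  by rewrite -(is_partialE hx h1) (is_partialE hx h2).
have : \sum_q (\sum_p d i p * g x p q) * invmx (g x) q j = d i j.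
  under eq_bigr do rewrite mulr_suml.
  rewrite exchange_big /= (bigD1 j)//= [X in _ + X]big1 ?addr0.
    under eq_bigr do rewrite -mulrA.
    rewrite -mulr_sumr; have := mulmxV (gu Sx) => /matrixP/(_ j j); rewrite !mxE eqxx => ->.
    by rewrite mulr1.
  move=> p pj; under eq_bigr do rewrite -mulrA.
  rewrite -mulr_sumr; have := mulmxV (gu Sx) => /matrixP/(_ p j); rewrite !mxE (negbTE pj) => ->.
  by rewrite mulr0.
rewrite -/(d i j) => <-.
rewrite exchange_big /= -sumrN; apply: eq_bigr => q _; rewrite -mulr_suml -mulNr; congr (_ * _).
by move: (key q); rewrite big_split /= => /eqP; rewrite addr_eq0 => /eqP.
Qed.

Variable eta : 'rV[R]_m -> R.
Hypothesis seta : smooth_on S eta.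

Definition coord_gradient (k : 'I_m) (x : 'rV[R]_m) : R :=
  \sum_l invmx (g x) k l * partial l eta x.

Lemma smooth_on_gradient k : smooth_on S (coord_gradient k).
Proof.
apply: smooth_on_sum => // l; apply: smooth_onM => //; first exact: smooth_on_invgram.
exact: smooth_on_partial.
Qed.

(** Put T1 = g^{ij} (d_i g_{jp}) v^p and T3 = g^{ij} (d_p g_{ij}) v^p, with v the gradient.
    Differentiating the inverse metric contributes - T1, the contracted symbol Gamma^k_{kl}
    contributes T3 / 2, and on the right the contraction of g^{ij} Gamma^k_{ij} with d_k eta is T1 -
    T3 / 2. The divergence form is the one that the normal component of the Ricci tensor produces
    below. *)
Lemma coord_laplacian_div x : S x ->
  \sum_k partial k (coord_gradient k) x +
  \sum_k \sum_l christoffel g k k l x * coord_gradient l x = coord_laplacian g eta x.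
Proof.
move=> Sx; have hx := rel_open_half oS Sx.
pose G i j := invmx (g x) i j; pose d l i j := partial l (fun z => g z i j) x.
pose v := coord_gradient ^~ x.
pose T1 := \sum_i \sum_j \sum_p G i j * d i j p * v p.
pose T3 := \sum_i \sum_j \sum_p G i j * d p i j * v p.
have Gs i j : G i j = G j i by exact: invmx_gram_sym.
have ds l i j : d l i j = d l j i by exact: partial_gram_sym.
have e1 : \sum_k partial k (coord_gradient k) x =
    - T1 + \sum_i \sum_j G i j * partial i (partial j eta) x.
  rewrite -sumrN -big_split; apply: eq_bigr => k _ /=.
  have pG l : is_partial k (fun z => invmx (g z) k l * partial l eta z) x
     (partial k (fun z => invmx (g z) k l) x * partial l eta x + G k l * partial k (partial l eta) x).
    apply: is_partialM; apply/has_partialP.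
      exact: smooth_on_has_partial (smooth_on_invgram k l) Sx.
    exact: smooth_on_has_partial (smooth_on_partial l seta) Sx.
  rewrite (is_partialE hx (is_partial_sum (r := index_enum 'I_m) pG)) big_split; congr (_ + _).
  under eq_bigr do rewrite (partial_invgram k k _ Sx) mulNr mulr_suml.
  rewrite sumrN; congr (- _); rewrite exchange_big; apply: eq_bigr => p _ /=.
  under eq_bigr do rewrite mulr_suml.
  rewrite exchange_big; apply: eq_bigr => q _ /=.
  by rewrite /v /coord_gradient mulr_sumr; apply: eq_bigr => l _; rewrite -!mulrA.
have e2 : \sum_k \sum_l christoffel g k k l x * v l = 2^-1 * T3.
  rewrite /T3 mulr_sumr.
  transitivity (\sum_k \sum_p \sum_l 2^-1 * (G k p * (d k l p + d l k p - d p k l) * v l)).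
    apply: eq_bigr => k _; rewrite exchange_big; apply: eq_bigr => l _ /=.
    by rewrite /christoffel -mulrA mulr_suml mulr_sumr; apply: eq_bigr.
  transitivity (\sum_k \sum_p \sum_l 2^-1 * (G k p * d l k p * v l) +
     (\sum_k \sum_p \sum_l 2^-1 * (G k p * d k l p * v l) -
      \sum_k \sum_p \sum_l 2^-1 * (G k p * d p k l * v l))).
    rewrite -sumrB -big_split; apply: eq_bigr => k _ /=.
    rewrite -sumrB -big_split; apply: eq_bigr => p _ /=.
    rewrite -sumrB -big_split; apply: eq_bigr => l _ /=; ring.
  (* The two remaining terms of the symbol cancel by the symmetry of the metric and its inverse,
     after exchanging [k] and [p]. *)
  rewrite [X in _ + (_ - X)]exchange_big /= [X in _ + X](_ : _ = 0) ?addr0.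
    by apply: eq_bigr => k _; rewrite mulr_sumr; apply: eq_bigr => p _; rewrite mulr_sumr.
  apply/eqP; rewrite subr_eq0; apply/eqP.
  apply: eq_bigr => k _; apply: eq_bigr => p _; apply: eq_bigr => l _.
  by rewrite (Gs p k) (ds k p l).
have e3 : \sum_i \sum_j G i j * (\sum_k christoffel g k i j x * partial k eta x) =
    T1 - 2^-1 * T3.
  transitivity (\sum_i \sum_j \sum_p 2^-1 * (G i j * (d i j p + d j i p - d p i j) * v p)).
    apply: eq_bigr => i _; apply: eq_bigr => j _; rewrite mulr_sumr.
    transitivity (\sum_k \sum_p 2^-1 * (G i j * (d i j p + d j i p - d p i j) * (G p k * partial k eta x))).
      apply: eq_bigr => k _; rewrite /christoffel -!mulrA mulr_suml !mulr_sumr.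
      by apply: eq_bigr => p _; rewrite -/(G k p) (Gs k p) /d; ring.
    rewrite exchange_big; apply: eq_bigr => p _ /=.
    by rewrite /v /coord_gradient !mulr_sumr.
  transitivity (2^-1 * T1 + 2^-1 * (\sum_i \sum_j \sum_p G i j * d j i p * v p) - 2^-1 * T3).
    rewrite /T1 /T3 !mulr_sumr -big_split -sumrB; apply: eq_bigr => i _ /=.
    rewrite !mulr_sumr -big_split -sumrB; apply: eq_bigr => j _ /=.
    rewrite !mulr_sumr -big_split -sumrB; apply: eq_bigr => p _ /=; ring.
  rewrite [X in _ + _ * X](_ : _ = T1); first by field.
  rewrite exchange_big; apply: eq_bigr => i _; apply: eq_bigr => j _ /=.
  by apply: eq_bigr => p _; rewrite Gs.
rewrite e1 e2 /coord_laplacian.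
under [RHS]eq_bigr do under eq_bigr do rewrite mulrBr.
under [RHS]eq_bigr do rewrite sumrB.
by rewrite sumrB e3; ring.
Qed.

End CoordinateMetric.

Lemma mulr_ordE (R : pzRingType) (m : nat) (c : R) : m%:R * c = \sum_(k < m) c.
Proof. by rewrite sumr_const card_ord mulr_natl. Qed.

(** * Curvature of A(u) eta^2 du^2 + B(u) g *)

Section WarpedMetric.
Variables (R : realType) (m : nat) (S : set 'rV[R]_m).
Hypothesis oS : open S.
Hypothesis SP : S `<=` open_halfspace.
Variable g : 'rV[R]_m -> 'M[R]_m.
Hypothesis sg : forall i j, smooth_on S (fun x => g x i j).
Hypothesis gT : forall x, S x -> (g x)^T = g x.
Hypothesis gu : forall x, S x -> g x \in unitmx.
Variable eta : 'rV[R]_m -> R.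
Hypothesis seta : smooth_on S eta.
Hypothesis eta_neq0 : forall x, S x -> eta x != 0.
Variables A B A1 B1 B2 : R -> R.
Hypothesis A_neq0 : forall u, 0 <= u < 1 -> A u != 0.
Hypothesis B_neq0 : forall u, 0 <= u < 1 -> B u != 0.
Let C := cylinder S.
Hypothesis dA : forall y, C y -> is_partial ord0 (fun y => A (y 0 ord0)) y (A1 (y 0 ord0)).
Hypothesis dB : forall y, C y -> is_partial ord0 (fun y => B (y 0 ord0)) y (B1 (y 0 ord0)).
Hypothesis dB1 : forall y, C y -> is_partial ord0 (fun y => B1 (y 0 ord0)) y (B2 (y 0 ord0)).

Definition warped_gram (y : 'rV[R]_m.+1) : 'M[R]_m.+1 :=
  diag1_mx (A (y 0 ord0) * eta (rv_tail y) ^+ 2) (B (y 0 ord0) *: g (rv_tail y)).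
Local Notation W := warped_gram.

Let oC : rel_open C. Proof. exact: rel_open_cylinder. Qed.
Let roS : rel_open S. Proof. exact: rel_open_open. Qed.

Let hC y : C y -> halfspace y. Proof. exact: rel_open_half. Qed.

Let deta i x : S x -> is_partial i eta x (partial i eta x).
Proof. by move=> Sx; apply/has_partialP; exact: smooth_on_has_partial Sx. Qed.

Let dg k i j x : S x -> is_partial k (fun x => g x i j) x (partial k (fun x => g x i j) x).
Proof. by move=> Sx; apply/has_partialP; exact: smooth_on_has_partial (sg i j) Sx. Qed.

Let tail_partial (f : 'rV[R]_m -> R) i y l : C y ->
  is_partial i f (rv_tail y) l -> is_partial (lift ord0 i) (fun y => f (rv_tail y)) y l.
Proof. by move=> [/andP[y0 _] Sy]; apply: is_partial_tail => //; exact: SP. Qed.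

Let split0 (h : R -> R) (f : 'rV[R]_m -> R) y l : C y ->
  is_partial ord0 (fun y => h (y 0 ord0)) y l ->
  partial ord0 (fun y => h (y 0 ord0) * f (rv_tail y)) y = l * f (rv_tail y).
Proof.
move=> Cy hl; apply: is_partialE; first exact: hC.
apply: is_partial_eq (is_partialM hl (is_partial_tail0 f y)).
by rewrite mulr0 addr0.
Qed.

Let splitS (h : R -> R) (f : 'rV[R]_m -> R) i y l : C y ->
  is_partial i f (rv_tail y) l ->
  partial (lift ord0 i) (fun y => h (y 0 ord0) * f (rv_tail y)) y = h (y 0 ord0) * l.
Proof.
move=> Cy fl; apply: is_partialE; first exact: hC.
apply: is_partial_eq (is_partialM (is_partial_head h i y) (tail_partial Cy fl)).
by rewrite mul0r add0r.
Qed.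

Let W00 : (fun y => W y ord0 ord0) = (fun y => A (y 0 ord0) * eta (rv_tail y) ^+ 2).
Proof. by apply/funext => y; rewrite diag1_mxE. Qed.

Let W0S j : (fun y => W y ord0 (lift ord0 j)) = fun=> 0.
Proof. by apply/funext => y; rewrite diag1_mxE. Qed.

Let WS0 j : (fun y => W y (lift ord0 j) ord0) = fun=> 0.
Proof. by apply/funext => y; rewrite diag1_mxE. Qed.

Let WSS i j : (fun y => W y (lift ord0 i) (lift ord0 j)) =
  fun y => B (y 0 ord0) * g (rv_tail y) i j.
Proof. by apply/funext => y; rewrite diag1_mxE mxE. Qed.

Let partial_cst0 (i : 'I_m.+1) y : C y -> partial i (fun=> 0 : R) y = 0.
Proof. by move=> Cy; apply: is_partialE; [exact: hC|exact: is_partial_cst]. Qed.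

Let d0W00 y : C y -> partial ord0 (fun y => W y ord0 ord0) y = A1 (y 0 ord0) * eta (rv_tail y) ^+ 2.
Proof. by move=> Cy; rewrite W00 (split0 (fun x => eta x ^+ 2) Cy (dA Cy)). Qed.

Let dSW00 i y : C y -> partial (lift ord0 i) (fun y => W y ord0 ord0) y =
  A (y 0 ord0) * (2 * eta (rv_tail y) * partial i eta (rv_tail y)).
Proof.
move=> Cy; have [_ Sx] := Cy; rewrite W00.
have hd : is_partial i (fun x => eta x ^+ 2) (rv_tail y)
    (2 * eta (rv_tail y) * partial i eta (rv_tail y)).
  have h2 := is_partialM (@deta i _ Sx) (@deta i _ Sx).
  have -> : (fun x => eta x ^+ 2) = (fun x => eta x * eta x).
    by apply/funext => x; rewrite expr2.
  by apply: is_partial_eq h2; ring.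
by rewrite (splitS A Cy hd).
Qed.

Let d0WSS i j y : C y -> partial ord0 (fun y => W y (lift ord0 i) (lift ord0 j)) y =
  B1 (y 0 ord0) * g (rv_tail y) i j.
Proof. by move=> Cy; rewrite WSS (split0 (fun x => g x i j) Cy (dB Cy)). Qed.

Let dSWSS k i j y : C y -> partial (lift ord0 k) (fun y => W y (lift ord0 i) (lift ord0 j)) y =
  B (y 0 ord0) * partial k (fun x => g x i j) (rv_tail y).
Proof. by move=> Cy; have [_ Sx] := Cy; rewrite WSS (splitS B Cy (@dg k i j _ Sx)). Qed.

Let dWE y (Cy : C y) :=
  (d0W00 Cy, (fun i => dSW00 i Cy), (fun i j => d0WSS i j Cy), (fun k i j => dSWSS k i j Cy),
   W0S, WS0, (fun i => partial_cst0 i Cy)).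

Lemma invmx_warped_gram y : C y -> invmx (W y) =
  diag1_mx (A (y 0 ord0) * eta (rv_tail y) ^+ 2)^-1
           ((B (y 0 ord0))^-1 *: invmx (g (rv_tail y))).
Proof.
move=> Cy; have [u Sx] := Cy; rewrite /W invmx_diag1.
- rewrite invmxZ// ?unitmxZ ?unitfE ?B_neq0//; exact: gu.
- by rewrite unitfE mulf_neq0 ?A_neq0// expf_neq0// eta_neq0.
- by rewrite unitmxZ ?unitfE ?B_neq0//; exact: gu.
Qed.

(** In this and the next lemmas the inverse metric is block diagonal, so a symbol with upper index 0
    keeps only the term [l = ord0] of its sum, and one with a tangential upper index only the other
    terms. *)
Lemma christoffel_warped_000 y : C y ->
  christoffel W ord0 ord0 ord0 y = 2^-1 * (A1 (y 0 ord0) / A (y 0 ord0)).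
Proof.
move=> Cy; have [u Sx] := Cy; rewrite /christoffel (invmx_warped_gram Cy) big_ord_recl big1 ?addr0.
  rewrite !diag1_mxE !(dWE Cy) addrK; congr (_ * _).
  by field; rewrite A_neq0// eta_neq0.
by move=> l _; rewrite !diag1_mxE mul0r.
Qed.

Lemma christoffel_warped_00S i y : C y ->
  christoffel W ord0 ord0 (lift ord0 i) y = partial i eta (rv_tail y) / eta (rv_tail y).
Proof.
move=> Cy; have [u Sx] := Cy; rewrite /christoffel (invmx_warped_gram Cy) big_ord_recl big1 ?addr0.
  rewrite !diag1_mxE !(dWE Cy).
  by field; rewrite A_neq0// eta_neq0.
by move=> l _; rewrite !diag1_mxE mul0r.
Qed.

Lemma christoffel_warped_0S0 i y : C y ->
  christoffel W ord0 (lift ord0 i) ord0 y = partial i eta (rv_tail y) / eta (rv_tail y).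
Proof.
move=> Cy; have [u Sx] := Cy; rewrite /christoffel (invmx_warped_gram Cy) big_ord_recl big1 ?addr0.
  rewrite !diag1_mxE !(dWE Cy).
  by field; rewrite A_neq0// eta_neq0.
by move=> l _; rewrite !diag1_mxE mul0r.
Qed.

Lemma christoffel_warped_0SS i j y : C y ->
  christoffel W ord0 (lift ord0 i) (lift ord0 j) y =
  - (2^-1 * (B1 (y 0 ord0) / A (y 0 ord0))) * (g (rv_tail y) i j / eta (rv_tail y) ^+ 2).
Proof.
move=> Cy; have [u Sx] := Cy; rewrite /christoffel (invmx_warped_gram Cy) big_ord_recl big1 ?addr0.
  rewrite !diag1_mxE !(dWE Cy).
  by field; rewrite A_neq0// eta_neq0.
by move=> l _; rewrite !diag1_mxE mul0r.
Qed.

Lemma christoffel_warped_S00 k y : C y ->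
  christoffel W (lift ord0 k) ord0 ord0 y =
  - (A (y 0 ord0) / B (y 0 ord0)) * (eta (rv_tail y) * coord_gradient g eta k (rv_tail y)).
Proof.
move=> Cy; have [u Sx] := Cy; rewrite /christoffel (invmx_warped_gram Cy) big_ord_recl !diag1_mxE mul0r add0r.
rewrite /coord_gradient !mulr_sumr; apply: eq_bigr => l _.
by rewrite !diag1_mxE !(dWE Cy) !mxE; field; rewrite B_neq0.
Qed.

Lemma christoffel_warped_S0S k j y : C y ->
  christoffel W (lift ord0 k) ord0 (lift ord0 j) y =
  (2^-1 * (B1 (y 0 ord0) / B (y 0 ord0))) * (k == j)%:R.
Proof.
move=> Cy; have [u Sx] := Cy; rewrite /christoffel (invmx_warped_gram Cy) big_ord_recl !diag1_mxE mul0r add0r.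
rewrite -(sum_invgramK gT gu k j Sx) !mulr_sumr; apply: eq_bigr => l _.
by rewrite !diag1_mxE !(dWE Cy) !mxE; field; rewrite B_neq0.
Qed.

Lemma christoffel_warped_SS0 k j y : C y ->
  christoffel W (lift ord0 k) (lift ord0 j) ord0 y =
  (2^-1 * (B1 (y 0 ord0) / B (y 0 ord0))) * (k == j)%:R.
Proof.
move=> Cy; have [u Sx] := Cy; rewrite /christoffel (invmx_warped_gram Cy) big_ord_recl !diag1_mxE mul0r add0r.
rewrite -(sum_invgramK gT gu k j Sx) !mulr_sumr; apply: eq_bigr => l _.
by rewrite !diag1_mxE !(dWE Cy) !mxE; field; rewrite B_neq0.
Qed.

Lemma christoffel_warped_SSS k i j y : C y ->
  christoffel W (lift ord0 k) (lift ord0 i) (lift ord0 j) y = christoffel g k i j (rv_tail y).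
Proof.
move=> Cy; have [u Sx] := Cy; rewrite /christoffel (invmx_warped_gram Cy) big_ord_recl !diag1_mxE mul0r add0r.
congr (_ * _); apply: eq_bigr => l _.
by rewrite !diag1_mxE !(dWE Cy) !mxE; field; rewrite B_neq0.
Qed.

(** The derivatives of Gamma^k_{00} = - (A / B) eta (grad eta)^k give - (A / B) (|grad eta|^2 + eta
    d_k (grad eta)^k). The square of the gradient cancels against Gamma^k_{00} Gamma^0_{0k}, and the
    products Gamma^k_{kl} Gamma^l_{00} complete the rest to the Laplacian in divergence form. *)
Lemma ricci_warped_00 y : C y ->
  ricci W ord0 ord0 y =
  - (A (y 0 ord0) / B (y 0 ord0)) * (eta (rv_tail y) * coord_laplacian g eta (rv_tail y)) +
  m%:R * (- (2^-1 * (B2 (y 0 ord0) / B (y 0 ord0) - B1 (y 0 ord0) ^+ 2 / B (y 0 ord0) ^+ 2)) +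
     (2^-1 * (B1 (y 0 ord0) / B (y 0 ord0))) * (2^-1 * (A1 (y 0 ord0) / A (y 0 ord0))) -
     (2^-1 * (B1 (y 0 ord0) / B (y 0 ord0))) ^+ 2).
Proof.
move=> Cy; have [u Sx] := Cy.
set x := rv_tail y in Sx *; set a := A (y 0 ord0); set b := B (y 0 ord0).
set a1 := A1 (y 0 ord0); set b1 := B1 (y 0 ord0); set b2 := B2 (y 0 ord0).
have dkk k : partial (lift ord0 k) (christoffel W (lift ord0 k) ord0 ord0) y =
    - (a / b) * (partial k eta x * coord_gradient g eta k x + eta x * partial k (coord_gradient g eta k) x).
  rewrite (partial_congr _ oC Cy (g := fun y => - (A (y 0 ord0) / B (y 0 ord0)) *
     (eta (rv_tail y) * coord_gradient g eta k (rv_tail y)))); last first.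
    by move=> z; rewrite inE; exact: christoffel_warped_S00.
  apply: (splitS (fun u => - (A u / B u)) (f := fun x => eta x * coord_gradient g eta k x)) => //.
  apply: is_partialM; first exact: deta.
  by apply/has_partialP; exact: smooth_on_has_partial (smooth_on_gradient roS sg gu seta k) Sx.
have d0k k : partial ord0 (christoffel W (lift ord0 k) ord0 (lift ord0 k)) y =
    2^-1 * (b2 / b - b1 ^+ 2 / b ^+ 2).
  rewrite (partial_congr _ oC Cy (g := fun y => (2^-1 * (B1 (y 0 ord0) / B (y 0 ord0))))); last first.
    by move=> z; rewrite inE => Cz; rewrite christoffel_warped_S0S// eqxx mulr1.
  apply: is_partialE; first exact: hC.
  apply: is_partial_eq (is_partialZ (c := 2^-1) (is_partialM (dB1 Cy) (is_partialV _ (dB Cy)))); last exact: B_neq0.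
  by rewrite -/b -/b1 -/b2; field; exact: B_neq0.
rewrite /ricci big_ord_recl subrr add0r.
under eq_bigr do rewrite dkk d0k.
rewrite big_ord_recl [X in _ + (X + _)]big1 ?add0r; last by move=> l _; rewrite subrr.
rewrite -(coord_laplacian_div roS sg gT gu seta Sx) mulr_ordE.
rewrite -[in RHS]big_split /= !mulr_sumr -!big_split /=; apply: eq_bigr => k _.
rewrite big_ord_recl christoffel_warped_SS0// christoffel_warped_000// christoffel_warped_S00//
  christoffel_warped_00S// eqxx mulr1.
rewrite (eq_bigr (fun l => - (a / b) * eta x * (christoffel g k k l x * coord_gradient g eta l x) -
   (2^-1 * (b1 / b)) ^+ 2 * (k == l)%:R)); last first.
  move=> l _; rewrite christoffel_warped_SSS// christoffel_warped_S00// !christoffel_warped_S0S//.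
  rewrite eq_sym -/x -/a -/b -/b1; case: eqP => _ /=; ring.
have delta : \sum_(l < m) (k == l)%:R = 1 :> R.
  rewrite (bigD1 k)//= eqxx big1 ?addr0// => l.
  by rewrite eq_sym => /negbTE ->.
rewrite sumrB -!mulr_sumr delta.
rewrite -/x -/a -/b -/b1 -/a1.
field; rewrite B_neq0// A_neq0// eta_neq0//.
Qed.

(** [B] is constant on the slices, so the tangential symbols are those of [g] and its Ricci tensor
    splits off. The Hessian of [eta] comes from the mixed symbol d_i eta / eta; its second
    derivatives stay in the order in which they arise. *)
Lemma ricci_warped_SS i j y : C y ->
  ricci W (lift ord0 i) (lift ord0 j) y = ricci g i j (rv_tail y) +
  (- (2^-1 * (B2 (y 0 ord0) / A (y 0 ord0) - B1 (y 0 ord0) * A1 (y 0 ord0) / A (y 0 ord0) ^+ 2)) -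
    (2^-1 * (A1 (y 0 ord0) / A (y 0 ord0)) + (m%:R - 2) * (2^-1 * (B1 (y 0 ord0) / B (y 0 ord0)))) *
      (2^-1 * (B1 (y 0 ord0) / A (y 0 ord0)))) * (g (rv_tail y) i j / eta (rv_tail y) ^+ 2)
  - (partial j (partial i eta) (rv_tail y) -
     \sum_l christoffel g l i j (rv_tail y) * partial l eta (rv_tail y)) / eta (rv_tail y).
Proof.
move=> Cy; have [u Sx] := Cy; have hx := rel_open_half roS Sx.
set x := rv_tail y in Sx hx *; set a := A (y 0 ord0); set b := B (y 0 ord0).
set a1 := A1 (y 0 ord0); set b1 := B1 (y 0 ord0); set b2 := B2 (y 0 ord0).
have d0 : partial ord0 (christoffel W ord0 (lift ord0 i) (lift ord0 j)) y =
    - (2^-1 * (b2 / a - b1 * a1 / a ^+ 2)) * (g x i j / eta x ^+ 2).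
  rewrite (partial_congr _ oC Cy (g := fun y => - (2^-1 * (B1 (y 0 ord0) / A (y 0 ord0))) *
     (g (rv_tail y) i j / eta (rv_tail y) ^+ 2))); last first.
    by move=> z; rewrite inE; exact: christoffel_warped_0SS.
  apply: (split0 (h := fun u => - (2^-1 * (B1 u / A u))) (fun x => g x i j / eta x ^+ 2)) => //.
  apply: is_partial_eq (is_partialN (is_partialZ (c := 2^-1) (is_partialM (dB1 Cy) (is_partialV _ (dA Cy))))); last exact: A_neq0.
  by rewrite -/a -/a1 -/b1 -/b2; field; exact: A_neq0.
have dj : partial (lift ord0 j) (christoffel W ord0 (lift ord0 i) ord0) y =
    partial j (partial i eta) x / eta x - partial i eta x * partial j eta x / eta x ^+ 2.
  rewrite (partial_congr _ oC Cy (g := fun y => partial i eta (rv_tail y) / eta (rv_tail y))); last first.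
    by move=> z; rewrite inE; exact: christoffel_warped_0S0.
  rewrite (@partial_tail _ _ (fun x => partial i eta x / eta x)); [|by case/andP: u|exact: SP].
  apply: is_partialE => //.
  have pe : is_partial j (partial i eta) x (partial j (partial i eta) x).
    by apply/has_partialP; exact: smooth_on_has_partial (smooth_on_partial i seta) Sx.
  apply: is_partial_eq (is_partialM pe (is_partialV _ (deta Sx))); last exact: eta_neq0.
  by field; exact: eta_neq0.
have dk k l p q : partial (lift ord0 p) (christoffel W (lift ord0 k) (lift ord0 l) (lift ord0 q)) y =
    partial p (christoffel g k l q) x.
  rewrite (partial_congr _ oC Cy (g := fun y => christoffel g k l q (rv_tail y))); last first.
    by move=> z; rewrite inE; exact: christoffel_warped_SSS.
  by rewrite partial_tail//; [case/andP: u|exact: SP].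
rewrite /ricci big_ord_recl d0 dj.
under eq_bigr do rewrite !dk.
rewrite -/x; set D := \sum_(_ < m) _.
rewrite big_ord_recl big_ord_recl.
rewrite christoffel_warped_000// !christoffel_warped_0SS// !christoffel_warped_0S0//.
rewrite (eq_bigr (fun l => (eta x)^-1 * (christoffel g l i j x * partial l eta x) +
   (2^-1 * (b1 / b)) * (2^-1 * (b1 / a)) * ((l == i)%:R * (g x j l / eta x ^+ 2)))); last first.
  move=> l _; rewrite christoffel_warped_00S// christoffel_warped_SSS// christoffel_warped_0SS//
    christoffel_warped_SS0// -/x -/a -/b -/b1; ring.
have delta : \sum_(l < m) (l == i)%:R * (g x j l / eta x ^+ 2) = g x j i / eta x ^+ 2.
  rewrite (bigD1 i)//= eqxx mul1r big1 ?addr0// => l /negbTE ->.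
  by rewrite mul0r.
rewrite big_split -!mulr_sumr /= delta.
set Q := \sum_k \sum_l (christoffel g k k l x * _ - _).
(* The row [k = ord0] has already contributed one copy of the same product, so the coefficient 1 - m
   here becomes -(m - 2) in total. *)
have -> : \sum_(k < m) \sum_(l < m.+1)
    (christoffel W (lift ord0 k) (lift ord0 k) l y * christoffel W l (lift ord0 i) (lift ord0 j) y -
     christoffel W (lift ord0 k) (lift ord0 j) l y * christoffel W l (lift ord0 i) (lift ord0 k) y) =
    (1 - m%:R) * ((2^-1 * (b1 / b)) * (2^-1 * (b1 / a)) * (g x i j / eta x ^+ 2)) + Q.
  have delta' : \sum_(k < m) (k == j)%:R * (g x i k / eta x ^+ 2) = g x i j / eta x ^+ 2.
    rewrite (bigD1 j)//= eqxx mul1r big1 ?addr0// => k /negbTE ->.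
    by rewrite mul0r.
  rewrite mulrBl mul1r -{1}delta' mulr_ordE mulr_sumr /Q -sumrB -big_split.
  apply: eq_bigr => k _ /=; rewrite big_ord_recl.
  rewrite !christoffel_warped_SS0// !christoffel_warped_0SS// eqxx mulr1.
  rewrite (eq_bigr (fun l => christoffel g k k l x * christoffel g l i j x -
     christoffel g k j l x * christoffel g l i k x)); last first.
    by move=> l _; rewrite !christoffel_warped_SSS.
  by rewrite -/x -/a -/b -/b1; ring.
rewrite (gram_entry_sym gT j i Sx) -/x -/a -/b -/a1 -/b1.
by field; rewrite A_neq0// B_neq0// eta_neq0.
Qed.

(** The normal component and the trace of the Hessian each contribute - Delta eta / (B eta); this is
    the factor 2 in front of the Laplacian, and for eta = 1/H the source of 2 H Delta H^-1. *)
Lemma scalar_curvature_warped y : C y ->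
  coord_scalar_curvature W y =
  (B (y 0 ord0))^-1 * (coord_scalar_curvature g (rv_tail y) -
     2 * coord_laplacian g eta (rv_tail y) / eta (rv_tail y)) -
  m%:R / (A (y 0 ord0) * eta (rv_tail y) ^+ 2) *
    (B2 (y 0 ord0) / B (y 0 ord0) - 2^-1 * (B1 (y 0 ord0) * A1 (y 0 ord0)) / (B (y 0 ord0) * A (y 0 ord0)) +
     (m%:R - 3) / 4 * (B1 (y 0 ord0) / B (y 0 ord0)) ^+ 2).
Proof.
move=> Cy; have [u Sx] := Cy.
rewrite {1}/coord_scalar_curvature (invmx_warped_gram Cy) big_ord_recl.
rewrite [X in X + _](_ : _ = (A (y 0 ord0) * eta (rv_tail y) ^+ 2)^-1 * ricci W ord0 ord0 y); last first.
  by rewrite big_ord_recl diag1_mxE big1 ?addr0// => l _; rewrite diag1_mxE mul0r.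
rewrite ricci_warped_00//.
set x := rv_tail y in Sx *; set a := A (y 0 ord0); set b := B (y 0 ord0).
set a1 := A1 (y 0 ord0); set b1 := B1 (y 0 ord0); set b2 := B2 (y 0 ord0).
set mu := - (2^-1 * (b2 / a - b1 * a1 / a ^+ 2)) -
    (2^-1 * (a1 / a) + (m%:R - 2) * (2^-1 * (b1 / b))) * (2^-1 * (b1 / a)).
(* The order of the two derivatives is reversed inside the trace by the symmetry of the inverse
   metric and of the Christoffel symbols, not by commuting partial derivatives. *)
have lap : coord_laplacian g eta x = \sum_i \sum_j invmx (g x) i j *
  (partial j (partial i eta) x - \sum_l christoffel g l i j x * partial l eta x).
  rewrite /coord_laplacian [LHS]exchange_big.
  apply: eq_bigr => i _.
  apply: eq_bigr => j _.
  rewrite (invmx_gram_sym gT j i Sx).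
  by under eq_bigr => l _ do rewrite (christoffel_sym roS gT l j i Sx).
have trg : \sum_i \sum_j invmx (g x) i j * g x i j = m%:R.
  rewrite (eq_bigr (fun=> 1)); first by rewrite sumr_const card_ord.
  by move=> i _; rewrite (sum_invgramK gT gu i i Sx) eqxx.
have -> : \sum_(i < m) \sum_(j < m.+1)
    diag1_mx (a * eta x ^+ 2)^-1 (b^-1 *: invmx (g x)) (lift ord0 i) j * ricci W (lift ord0 i) j y =
  b^-1 * coord_scalar_curvature g x + b^-1 * (mu / eta x ^+ 2) * m%:R -
  b^-1 * (eta x)^-1 * coord_laplacian g eta x.
  rewrite -trg lap /coord_scalar_curvature !mulr_sumr -big_split -sumrB; apply: eq_bigr => i _ /=.
  rewrite big_ord_recl !diag1_mxE mul0r add0r !mulr_sumr -big_split -sumrB.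
  apply: eq_bigr => j _; rewrite diag1_mxE.
  rewrite mxE.
  rewrite (ricci_warped_SS i j Cy).
  rewrite -/x -/a -/b -/a1 -/b1 -/b2 -/mu.
  by move: (ricci g i j x) => r /=; ring.
have a0 : a != 0 by exact: A_neq0.
have b0 : b != 0 by exact: B_neq0.
have e0 : eta x != 0 by exact: eta_neq0.
rewrite /mu; move: (coord_scalar_curvature g x) (coord_laplacian g eta x) (eta x) e0 => s l e e0.
by field; rewrite a0 b0 e0.
Qed.

(** The normal is - d_u / sqrt(A eta^2), pointing towards decreasing [u], hence the sign. The slice
    is umbilic: its second fundamental form is a multiple of [g], and the trace against (B g)^-1
    yields the factor m. *)
Lemma mean_curvature_warped y : C y -> 0 < A (y 0 ord0) * eta (rv_tail y) ^+ 2 ->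
  coord_mean_curvature W y =
  - (m%:R / 2) * (B1 (y 0 ord0) / B (y 0 ord0)) / Num.sqrt (A (y 0 ord0) * eta (rv_tail y) ^+ 2).
Proof.
move=> Cy wpos; have [u Sx] := Cy.
set x := rv_tail y in Sx wpos *; set a := A (y 0 ord0) in wpos *; set b := B (y 0 ord0).
set w := a * eta x ^+ 2 in wpos *; set b1 := B1 (y 0 ord0).
have sw : Num.sqrt w != 0 by rewrite gt_eqF// sqrtr_gt0.
have ww : w = Num.sqrt w ^+ 2 by rewrite sqr_sqrtr// ltW.
have nu0 : outward_normal W y ord0 = - (Num.sqrt w)^-1.
  rewrite /outward_normal (invmx_warped_gram Cy) !diag1_mxE -/x -/a -/w sqrtrV ?ltW//.
  by rewrite {1}ww; field.
have II i j : second_fundamental_form W y i j = - (2^-1 * b1 / Num.sqrt w) * g x i j.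
  rewrite mxE big_ord_recl big_ord_recl [X in _ + X + _]big1 ?addr0; last first.
    by move=> l _; rewrite /W diag1_mxE !mul0r.
  rewrite [X in _ + X]big1 ?addr0; last first.
    move=> k _; rewrite big_ord_recl {1}/W diag1_mxE !mul0r add0r big1// => l _.
    by rewrite /outward_normal (invmx_warped_gram Cy) !diag1_mxE oppr0 !mul0r mulr0.
  rewrite {1}/W diag1_mxE christoffel_warped_0SS// nu0 -/x -/a -/w -/b1.
  have e0 : eta x != 0 by exact: eta_neq0.
  have a0 : a != 0 by exact: A_neq0.
  rewrite /w; field.
  by rewrite a0 e0 sw.
have hh : row' ord0 (col' ord0 (W y)) = b *: g x.
  by apply/matrixP => i j; rewrite !mxE !liftK mxE.
rewrite /coord_mean_curvature hh invmxZ ?unitmxZ ?unitfE ?B_neq0//; last exact: gu.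
have -> : second_fundamental_form W y = - (2^-1 * b1 / Num.sqrt w) *: g x.
  by apply/matrixP => i j; rewrite II mxE.
rewrite -scalemxAl -scalemxAr mulVmx ?gu// scalerA mxtraceZ mxtrace1.
by field; rewrite sw /= B_neq0.
Qed.

End WarpedMetric.

(** * The cylinder over a closed manifold *)

Section UnitInterval.
Variable R : realType.

Definition unit_itv : topologicalType := set_type (`[0 : R, 1]%classic).

Definition itv_val (t : unit_itv) : R := set_val t.

Lemma itv_valP t : 0 <= itv_val t <= 1.
Proof. by case: t => t ht; have := set_mem ht; rewrite /itv_val /= in_itv. Qed.

Lemma clamp_subproof (u : R) : Num.max 0 (Num.min u 1) \in `[0 : R, 1]%classic.
Proof. by rewrite inE /= in_itv /= le_max lexx /= ge_max ler01 ge_min lexx orbT. Qed.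

(** A continuous retraction defined on the whole line: [chart_inv] has to be total, and the subtype
    inherits compactness and connectedness from the segment through this map. *)
Definition clamp (u : R) : unit_itv := 
  exist (fun x => x \in `[0 : R, 1]%classic) _ (clamp_subproof u).

Lemma itv_val_clamp u : 0 <= u <= 1 -> itv_val (clamp u) = u.
Proof.
by move=> /andP[u0 u1]; change (Num.max 0 (Num.min u 1) = u); rewrite min_l// max_r.
Qed.

Lemma itv_val_inj : injective itv_val.
Proof. by move=> [s hs] [t ht] st; apply: eq_exist. Qed.

Lemma itv_valK t : clamp (itv_val t) = t.
Proof. by apply: itv_val_inj; rewrite itv_val_clamp// itv_valP. Qed.

Lemma itv_val_continuous : continuous itv_val.
Proof. exact: initial_continuous. Qed.

Lemma clamp_continuous : continuous clamp.
Proof.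
apply: continuous_comp_initial => u.
apply: (@continuous_comp _ _ _ (fun u : R => Num.min u 1) (fun u => Num.max 0 u)).
  by apply: continuous_min; [exact: cvg_id|exact: cvg_cst].
by apply: continuous_max; [exact: cvg_cst|exact: cvg_id].
Qed.

Lemma clamp_surj : [set: unit_itv] = clamp @` `[0 : R, 1]%classic.
Proof.
apply/seteqP; split=> // t _; exists (itv_val t); last exact: itv_valK.
by rewrite /= in_itv; exact: itv_valP.
Qed.

Lemma unit_itv_compact : compact [set: unit_itv].
Proof.
rewrite clamp_surj; apply: continuous_compact; last exact: segment_compact.
by apply: continuous_subspaceT; exact: clamp_continuous.
Qed.

Lemma unit_itv_connected : connected [set: unit_itv].
Proof.
rewrite clamp_surj; apply: connected_continuous_connected; first exact: segment_connected.
by apply: continuous_subspaceT; exact: clamp_continuous.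
Qed.

Lemma unit_itv_hausdorff : hausdorff_space unit_itv.
Proof.
move=> s t st; apply: itv_val_inj; apply: (@norm_hausdorff _ R) => A B hA hB.
have [r [Ar Br]] := st _ _ (itv_val_continuous hA) (itv_val_continuous hB).
by exists (itv_val r).
Qed.

(* Both ends of the interval are seen at [u = 0] through one of the two maps. *)
Definition side (b : bool) (u : R) : R := if b then u else 1 - u.

Lemma sideK b : involutive (side b).
Proof. by case: b => u //=; rewrite /side opprB addrC subrK. Qed.

Lemma side01 b u : 0 <= u <= 1 -> 0 <= side b u <= 1.
Proof.
by case: b => //= /andP[u0 u1]; rewrite /side subr_ge0 u1 lerBlDr lerDl u0.
Qed.

Lemma side_continuous b : continuous (side b).
Proof.
case: b => u; first exact: cvg_id.
by apply: cvgB; [exact: cvg_cst|exact: cvg_id].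
Qed.

(** The derivative of [side b]. *)
Definition side_sign (b : bool) : R := if b then 1 else -1.

Lemma side_sign_sqr b : side_sign b * side_sign b = 1.
Proof. by case: b; rewrite /side_sign ?mulrNN mulr1. Qed.

End UnitInterval.

Lemma prod_hausdorff (S T : topologicalType) :
  hausdorff_space S -> hausdorff_space T -> hausdorff_space (S * T)%type.
Proof.
move=> hS hT [s t] [s' t'] st; congr (_, _).
- apply: hS => A B hA hB; have [[r q] [Ar Br]] := st (fst @^-1` A) (fst @^-1` B)
    (cvg_fst hA) (cvg_fst hB).
  by exists r.
- apply: hT => A B hA hB; have [[r q] [Ar Br]] := st (snd @^-1` A) (snd @^-1` B)
    (cvg_snd hA) (cvg_snd hB).
  by exists q.
Qed.

(** Every horizontal line meets the vertical line over [s0]; the resulting crosses cover the product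
    and share the point [(s0, t0)]. *)
Lemma prod_connected (S T : topologicalType) :
  connected [set: S] -> connected [set: T] -> connected [set: (S * T)%type].
Proof.
move=> cS cT.
have [[[s0 t0] _]|e] := pselect ([set: (S * T)%type] !=set0); last first.
  have -> : [set: (S * T)%type] = set0.
    by apply/seteqP; split=> // x _; apply: e; exists x.
  exact: connected0.
have cH t : connected ((fun s : S => (s, t)) @` [set: S]).
  apply: connected_continuous_connected => //; apply: continuous_subspaceT => s.
  by apply: cvg_pair; [exact: cvg_id|exact: cvg_cst].
have cV : connected ((fun t : T => (s0, t)) @` [set: T]).
  apply: connected_continuous_connected => //; apply: continuous_subspaceT => t.
  by apply: cvg_pair; [exact: cvg_cst|exact: cvg_id].
have -> : [set: (S * T)%type] = \bigcup_(t in [set: T])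
    ((fun t : T => (s0, t)) @` [set: T] `|` (fun s : S => (s, t)) @` [set: S]).
  by apply/seteqP; split=> // -[s t] _; exists t => //; right; exists s.
apply: bigcup_connected.
  by exists (s0, t0) => t _; left; exists t0.
move=> t _; apply: connectedU => //.
by exists (s0, t); split; [exists t|exists s0].
Qed.

Lemma open_within_preimage (S T : topologicalType) (A : set S) (f : S -> T) (B : set T) :
  open A -> {within A, continuous f} -> open B -> open (A `&` f @^-1` B).
Proof.
move=> oA cf oB; have cf' : {in A, continuous f} by rewrite -continuous_open_subspace.
by have /continuous_inP := cf'; apply.
Qed.

Lemma rel_openI (R : realType) (m : nat) (U V : set 'rV[R]_m) :
  rel_open U -> open V -> rel_open (U `&` V).
Proof.
move=> [U' oU' ->] oV; exists (U' `&` V); first exact: openI.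
by rewrite setIAC.
Qed.

(** * The product of a closed manifold with [0, 1] as a manifold with boundary *)

Section Cylinder.
Variables (R : realType) (m : nat) (M : compact_manifold R m).
Hypothesis bM : manifold_boundary M = set0.

Lemma chart_img_interior (c : chart M) : chart_img c `<=` open_halfspace.
Proof.
move=> x [p cp <-] i i0; rewrite lt_neqAle; apply/andP; split.
  apply/eqP => pi0; have : manifold_boundary M p by exists c => //; exists i.
  by rewrite bM.
have [V _ VE] := chart_map_image c.
have : (chart_map c @` chart_dom c) (chart_map c p) by exists p.
by rewrite VE => -[_]; apply.
Qed.

(** Relatively open in the half-space and disjoint from its face, hence open in the whole space.
    This frees the face for the interval coordinate of the product. *)
Lemma chart_img_open (c : chart M) : open (chart_img c).
Proof.
have [V oV VE] := chart_map_image c; rewrite openE => x cx.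
have [Vx _] : (V `&` @halfspace R m) x by rewrite -VE.
have px := chart_img_interior cx.
have nV : \forall z \near x, V z by exact: open_nbhs_nbhs.
have nP : \forall z \near x, forall i : 'I_m, val i = 0%N -> 0 < (z : 'rV[R]_m) 0 i.
  apply: (@filter_forall _ _ (fun i (z : 'rV[R]_m) => val i = 0%N -> 0 < z 0 i) (nbhs x)) => i.
  have [i0|i0] := eqVneq (val i) 0%N; last first.
    by apply: filterE => z iz; rewrite iz in i0.
  have h : (fun z : 'rV[R]_m => z 0 i) @ x --> x 0 i by exact: coord_continuous.
  have hp : \forall z \near x, 0 < (z : 'rV[R]_m) 0 i.
    by move/cvgr_gt : h; apply; exact: px.
  by apply: filterS hp.
rewrite /interior /=; change (\forall z \near x, chart_img c z).
apply: filterS2 nV nP => z Vz Pz; rewrite /chart_img VE; split=> // i i0.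
exact/ltW/Pz.
Qed.

Definition chart_overlap (c d : chart M) : set 'rV[R]_m :=
  [set x | chart_img c x /\ chart_dom d (chart_inv c x)].

Lemma chart_overlap_open c d : open (chart_overlap c d).
Proof.
apply: (@open_within_preimage _ _ (chart_img c) (chart_inv c) (chart_dom d)).
- exact: chart_img_open.
- exact: chart_inv_continuous.
- exact: chart_dom_open.
Qed.

Lemma chart_overlap_interior c d : chart_overlap c d `<=` open_halfspace.
Proof. by move=> x [/chart_img_interior]. Qed.

(** The flag selects the end of the interval that lies at [u = 0]. The opposite end is removed, so
    that [u] ranges over [0, 1[ and the image is relatively open in the half-space. *)
Definition cyl_dom (c : chart M * bool) : set (M * unit_itv R)%type :=
  [set p | chart_dom c.1 p.1 /\ side c.2 (itv_val p.2) < 1].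

Definition cyl_map (c : chart M * bool) (p : M * unit_itv R) : 'rV[R]_m.+1 :=
  rv_cons (side c.2 (itv_val p.2)) (chart_map c.1 p.1).

Definition cyl_inv (c : chart M * bool) (y : 'rV[R]_m.+1) : (M * unit_itv R)%type :=
  (chart_inv c.1 (rv_tail y), clamp (side c.2 (y 0 ord0))).

(** Geometric quantities are evaluated in this chart. The cut at 1/2 gives flag [true] at t = 0 and
    [false] at t = 1, so each boundary point is read at [u = 0], on the face where the outward
    normal is defined. *)
Definition cyl_at (p : M * unit_itv R) : (chart M * bool)%type :=
  (chart_at p.1, itv_val p.2 < 2^-1).

Lemma itv_val_cyl_inv c (y : 'rV[R]_m.+1) : 0 <= y 0 ord0 < 1 ->
  itv_val (cyl_inv c y).2 = side c.2 (y 0 ord0).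
Proof.
by move=> /andP[y0 y1]; rewrite itv_val_clamp// side01// y0 ltW.
Qed.

Lemma cyl_map_image c : cyl_map c @` cyl_dom c = cylinder (chart_img c.1).
Proof.
apply/seteqP; split=> [_ [[p t] /= [cp t1] <-]|y [y01 [p cp pE]]].
  split; last by rewrite rv_consK; exists p.
  by rewrite rv_cons0 t1 andbT; case/andP: (side01 c.2 (itv_valP t)).
have st : itv_val (clamp (side c.2 (y 0 ord0))) = side c.2 (y 0 ord0).
  exact: (itv_val_cyl_inv c y01).
exists (p, clamp (side c.2 (y 0 ord0))).
  by split=> //=; rewrite st sideK; case/andP: y01.
by rewrite /cyl_map /= st sideK pE rv_tailK.
Qed.

Lemma cyl_atP p : cyl_dom (cyl_at p) p.
Proof.
split; first exact: chart_atP.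
have /andP[t0 t1] := itv_valP p.2.
rewrite /cyl_at /side /=; case: (ltP (itv_val p.2) 2^-1) => h.
  by apply: lt_le_trans h _; rewrite invf_le1// ler1n.
by rewrite ltrBlDr ltrDl; apply: lt_le_trans h; rewrite invr_gt0.
Qed.

Lemma side_itv_continuous b : continuous (fun p : (M * unit_itv R)%type => side b (itv_val p.2)).
Proof.
move=> p; apply: (@cvg_comp _ _ _ (fun p : (M * unit_itv R)%type => itv_val p.2) (@side R b) _ (nbhs (itv_val p.2))).
  apply: (@cvg_comp _ _ _ (@snd M (unit_itv R)) (@itv_val R) _ (nbhs p.2)).
    exact: cvg_snd.
  exact: itv_val_continuous.
exact: side_continuous.
Qed.

Lemma side_coord_continuous b : continuous (fun y : 'rV[R]_m.+1 => side b (y 0 ord0)).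
Proof.
move=> y; apply: (@continuous_comp _ _ _ (fun y : 'rV[R]_m.+1 => y 0 ord0) (@side R b)).
  exact: coord_continuous.
exact: side_continuous.
Qed.

Lemma cyl_dom_open c : open (cyl_dom c).
Proof.
have -> : cyl_dom c = (fst @^-1` chart_dom c.1) `&`
    ((fun p : (M * unit_itv R)%type => side c.2 (itv_val p.2)) @^-1` [set u | u < 1]).
  by apply/seteqP; split=> p.
apply: openI.
  by apply: open_comp; [move=> p _; exact: cvg_fst|exact: chart_dom_open].
by apply: open_comp; [move=> p _; exact: side_itv_continuous|exact: open_lt].
Qed.

Lemma cyl_mapK c p : cyl_dom c p -> cyl_inv c (cyl_map c p) = p.
Proof.
case: p => p t [/= cp _]; rewrite /cyl_inv /cyl_map /= rv_consK chart_mapK//.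
by rewrite rv_cons0 sideK itv_valK.
Qed.

Lemma cyl_map_rel_open c : exists2 V : set 'rV[R]_m.+1,
  open V & cyl_map c @` cyl_dom c = V `&` @halfspace R m.+1.
Proof. by rewrite cyl_map_image; apply: rel_open_cylinder; exact: chart_img_open. Qed.

Lemma cyl_map_continuous c : {within cyl_dom c, continuous (cyl_map c)}.
Proof.
apply/subspace_continuousP => p [cp _].
apply: (@cvg_mx R 1 m.+1 _ (within (cyl_dom c) (nbhs p)) _) => i j; rewrite ord1.
case: (unliftP ord0 j) => [k|] ->.
  rewrite rv_consS (_ : (fun t => _) = (fun t => chart_map c.1 t.1 0 k)); last first.
    by apply/funext => t; rewrite rv_consS.
  have h : chart_map c.1 @ within (chart_dom c.1) (nbhs p.1) --> chart_map c.1 p.1.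
    by have /subspace_continuousP := chart_map_continuous (c := c.1); apply.
  have h1 : fst @ within (cyl_dom c) (nbhs p) --> within (chart_dom c.1) (nbhs p.1).
    move=> A hA; change (\forall q \near p, cyl_dom c q -> A q.1).
    have f1 : fst @ p --> p.1 by exact: cvg_fst.
    have h2 : \forall q \near p, chart_dom c.1 q.1 -> A q.1 by exact: (f1 _ hA).
    by apply: filterS h2 => q hq [/hq].
  exact: (cvg_comp _ _ (cvg_comp _ _ h1 h) (@coord_continuous R 1 m 0 k _)).
rewrite rv_cons0 (_ : (fun t => _) = (fun t => side c.2 (itv_val t.2))); last first.
  by apply/funext => t; rewrite rv_cons0.
have h : (fun t : (M * unit_itv R)%type => side c.2 (itv_val t.2)) @ nbhs p --> side c.2 (itv_val p.2).
  exact: side_itv_continuous.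
by apply: cvg_trans h; apply: cvg_app; exact: cvg_within.
Qed.

Lemma cyl_inv_continuous c : {within cyl_map c @` cyl_dom c, continuous (cyl_inv c)}.
Proof.
rewrite cyl_map_image; apply/subspace_continuousP => y [y01 Sy].
have h : chart_inv c.1 @ within (chart_img c.1) (nbhs (rv_tail y)) --> chart_inv c.1 (rv_tail y).
  by have /subspace_continuousP := chart_inv_continuous (c := c.1); apply.
have ht : @rv_tail R m @ within (cylinder (chart_img c.1)) (nbhs y) -->
    within (chart_img c.1) (nbhs (rv_tail y)).
  move=> A hA; change (\forall z \near y, cylinder (chart_img c.1) z -> A (rv_tail z)).
  have h2 : \forall z \near y, chart_img c.1 (rv_tail z) -> A (rv_tail z).
    exact: (rv_tail_continuous hA).
  by apply: filterS h2 => z hz [_ /hz].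
have hc : (fun z : 'rV[R]_m.+1 => clamp (side c.2 (z 0 ord0))) @ nbhs y -->
    clamp (side c.2 (y 0 ord0)).
  apply: (@continuous_comp _ _ _ (fun z : 'rV[R]_m.+1 => side c.2 (z 0 ord0)) (@clamp R)).
    exact: side_coord_continuous.
  exact: clamp_continuous.
have hc' : (fun z : 'rV[R]_m.+1 => clamp (side c.2 (z 0 ord0))) @
    within (cylinder (chart_img c.1)) (nbhs y) --> clamp (side c.2 (y 0 ord0)).
  by apply: cvg_trans hc; apply: cvg_app; exact: cvg_within.
exact: (cvg_pair (cvg_comp _ _ ht h) hc').
Qed.

Definition cyl_overlap (c d : chart M * bool) : set 'rV[R]_m.+1 :=
  [set y | (cyl_map c @` cyl_dom c) y /\ cyl_dom d (cyl_inv c y)].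

(** For equal flags the last condition is [u < 1] again; for different flags it says [0 < u] and
    removes the boundary slice, which only one of the two charts contains. *)
Lemma cyl_overlapE c d : cyl_overlap c d =
  cylinder (chart_overlap c.1 d.1) `&` [set y : 'rV[R]_m.+1 | side d.2 (side c.2 (y 0 ord0)) < 1].
Proof.
apply/seteqP; split=> [y []|y [[y01 [Sy dy]] y1]].
  rewrite cyl_map_image => -[y01 Sy] [dy]; rewrite itv_val_cyl_inv//.
split; first by rewrite cyl_map_image.
by split=> //; rewrite itv_val_cyl_inv.
Qed.

Lemma cyl_overlap_rel_open c d : rel_open (cyl_overlap c d).
Proof.
rewrite cyl_overlapE; apply: rel_openI.
  by apply: rel_open_cylinder; exact: chart_overlap_open.
apply: (@open_comp _ _ (fun y : 'rV[R]_m.+1 => side d.2 (side c.2 (y 0 ord0))) [set u : R | u < 1]);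
  last exact: open_lt.
move=> y _.
apply: (@continuous_comp _ _ _ (fun z : 'rV[R]_m.+1 => side c.2 (z 0 ord0)) (@side R d.2)).
  exact: side_coord_continuous.
exact: side_continuous.
Qed.

Lemma smooth_on_side (U : set 'rV[R]_m.+1) b f : rel_open U -> smooth_on U f ->
  smooth_on U (fun y => side b (f y)).
Proof.
move=> oU sf; case: b => //.
by apply: smooth_onB => //; exact: smooth_on_cst.
Qed.

Lemma cyl_transition c d y : cyl_overlap c d y ->
  cyl_map d (cyl_inv c y) =
  rv_cons (side d.2 (side c.2 (y 0 ord0))) (chart_map d.1 (chart_inv c.1 (rv_tail y))).
Proof. by rewrite cyl_overlapE => -[[y01 _] _]; rewrite /cyl_map itv_val_cyl_inv. Qed.

Lemma cyl_transition_smooth c d k :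
  smooth_on (cyl_overlap c d) (fun y => cyl_map d (cyl_inv c y) 0 k).
Proof.
have oO := cyl_overlap_rel_open c d.
case: (unliftP ord0 k) => [j|] ->.
  have : smooth_on (cylinder (chart_overlap c.1 d.1))
      (fun y => chart_map d.1 (chart_inv c.1 (rv_tail y)) 0 j).
    apply: (@smooth_on_tail _ _ _ (fun x => chart_map d.1 (chart_inv c.1 x) 0 j)).
    - exact: chart_overlap_open.
    - exact: chart_overlap_interior.
    - exact: transition_smooth.
  have sub : cyl_overlap c d `<=` cylinder (chart_overlap c.1 d.1).
    by rewrite cyl_overlapE; exact: subIsetl.
  move=> /(smooth_onW sub); apply: smooth_on_congr => // y; rewrite inE => Oy.
  by rewrite cyl_transition// rv_consS.
have : smooth_on (cyl_overlap c d) (fun y => side d.2 (side c.2 (y 0 ord0))).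
  by do 2 apply: smooth_on_side => //; exact: smooth_on_coord.
apply: smooth_on_congr => // y; rewrite inE => Oy.
by rewrite cyl_transition// rv_cons0.
Qed.

Lemma cyl_compact : compact [set: (M * unit_itv R)%type].
Proof. by rewrite -setXTT; apply: compact_setX; [exact: manifold_compact|exact: unit_itv_compact]. Qed.

Definition cyl_manifold : compact_manifold R m.+1 :=
  @CompactManifold R m.+1 (M * unit_itv R)%type
    (prod_hausdorff (@manifold_hausdorff _ _ M) (@unit_itv_hausdorff R)) cyl_compact
    (chart M * bool)%type cyl_dom cyl_map cyl_inv cyl_at cyl_atP cyl_dom_open cyl_mapK
    cyl_map_rel_open cyl_map_continuous cyl_inv_continuous cyl_transition_smooth.

Lemma cyl_img (c : chart M * bool) : @chart_img _ _ cyl_manifold c = cylinder (chart_img c.1).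
Proof. exact: cyl_map_image. Qed.

Lemma cyl_boundary : @manifold_boundary _ _ cyl_manifold =
  [set p : cyl_manifold | itv_val p.2 = 1] `|` [set p : cyl_manifold | itv_val p.2 = 0].
Proof.
apply/seteqP; split=> [[p t] [[c b] _ [i i0]]|[p t] pt].
  have -> : i = ord0 by apply: val_inj.
  rewrite /= /cyl_map rv_cons0 /=; case: b => /=; rewrite /side; first by right.
  by move=> /eqP; rewrite subr_eq0 eq_sym => /eqP; left.
have cp := chart_atP p.
case: pt => /= t01.
- exists (chart_at p, false); first by split; rewrite //= t01 /side subrr.
  by exists ord0; rewrite //= /cyl_map rv_cons0 /= t01 /side subrr.
- exists (chart_at p, true); first by split; rewrite //= t01 /side.
  by exists ord0; rewrite //= /cyl_map rv_cons0 /= t01.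
Qed.

End Cylinder.

Section Diag1Forms.
Variables (R : realType) (m : nat).

Lemma diag1_mx_form (a : R) (M : 'M[R]_m) (v : 'rV[R]_m.+1) :
  (v *m diag1_mx a M *m v^T) 0 0 =
  a * v 0 ord0 ^+ 2 + (rv_tail v *m M *m (rv_tail v)^T) 0 0.
Proof.
have e0 : (v *m diag1_mx a M) 0 ord0 = a * v 0 ord0.
  rewrite mxE big_ord_recl big1 ?addr0 ?diag1_mx00 1?mulrC// => k _.
  by rewrite diag1_mxS0 mulr0.
have eS j : (v *m diag1_mx a M) 0 (lift ord0 j) = (rv_tail v *m M) 0 j.
  rewrite mxE big_ord_recl diag1_mx0S mulr0 add0r mxE; apply: eq_bigr => k _.
  by rewrite diag1_mxSS mxE.
rewrite mxE big_ord_recl e0 mxE expr2 mulrA; congr (_ + _).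
by rewrite mxE; apply: eq_bigr => k _; rewrite eS !mxE.
Qed.

(** Meant for the Jacobian [J] of the inclusion of a slice: the first coordinate is constant there,
    so its column vanishes and only the block [M] is pulled back. *)
Lemma diag1_mx_pullback (n : nat) (a : R) (M : 'M[R]_m) (J : 'M[R]_(n, m.+1)) (K : 'M[R]_(n, m)) :
  (forall i, J i ord0 = 0) -> (forall i j, J i (lift ord0 j) = K i j) ->
  J *m diag1_mx a M *m J^T = K *m M *m K^T.
Proof.
move=> J0 JK.
have e0 i : (J *m diag1_mx a M) i ord0 = 0.
  by rewrite mxE big1// => k _; case: (unliftP ord0 k) => [l|] ->;
    rewrite ?diag1_mxS0 ?mulr0// J0 mul0r.
have eS i j : (J *m diag1_mx a M) i (lift ord0 j) = (K *m M) i j.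
  rewrite mxE big_ord_recl diag1_mx0S mulr0 add0r mxE; apply: eq_bigr => k _.
  by rewrite diag1_mxSS JK.
apply/matrixP => i j; rewrite mxE big_ord_recl e0 mul0r add0r mxE.
by apply: eq_bigr => k _; rewrite eS; congr (_ * _); rewrite !mxE.
Qed.

End Diag1Forms.

Lemma posdef_unitmx (R : realType) (m : nat) (M : 'M[R]_m) :
  (forall v : 'rV[R]_m, v != 0 -> 0 < (v *m M *m v^T) 0 0) -> M \in unitmx.
Proof.
move=> pM; rewrite -row_free_unit -kermx_eq0; apply/negPn/negP => /rowV0Pn[v vM v0].
have /sub_kermxP vM0 := vM.
by have := pM _ v0; rewrite vM0 mul0mx mxE ltxx.
Qed.

(** * The warped metric on the product and its outer end *)

Section CylinderMetric.
Variables (R : realType) (m : nat) (M : compact_manifold R m).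
Hypothesis bM : manifold_boundary M = set0.
Variable g : riemannian_metric M.
Variable eta : M -> R.
Hypothesis seta : smooth_function eta.
Hypothesis eta_gt0 : forall p, 0 < eta p.
Variables A B : R -> R.
Hypothesis A_gt0 : forall s, 0 <= s <= 1 -> 0 < A s.
Hypothesis B_gt0 : forall s, 0 <= s <= 1 -> 0 < B s.
Hypothesis sA : forall (U : set 'rV[R]_m.+1) b, rel_open U ->
  smooth_on U (fun y => A (side b (y 0 ord0))).
Hypothesis sB : forall (U : set 'rV[R]_m.+1) b, rel_open U ->
  smooth_on U (fun y => B (side b (y 0 ord0))).
Local Notation N := (cyl_manifold bM).

Lemma gram_unitmx c x : chart_img c x -> g c x \in unitmx.
Proof. by move=> cx; apply: posdef_unitmx => v; exact: gram_posdef. Qed.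

Definition cyl_gram (c : chart N) (y : 'rV[R]_m.+1) : 'M[R]_m.+1 :=
  warped_gram (g c.1) (fun x => eta (chart_inv c.1 x))
    (fun u => A (side c.2 u)) (fun u => B (side c.2 u)) y.

Lemma side01_lt b (u : R) : 0 <= u < 1 -> 0 <= side b u <= 1.
Proof. by move=> /andP[u0 u1]; rewrite side01// u0 ltW. Qed.

Lemma cyl_gram_smooth (c : chart N) i j : smooth_on (chart_img c) (fun y => cyl_gram c y i j).
Proof.
rewrite cyl_img.
have oC := rel_open_cylinder (chart_img_open bM (c := c.1)).
have tl f : smooth_on (chart_img c.1) f ->
    smooth_on (cylinder (chart_img c.1)) (fun y => f (rv_tail y)).
  by apply: smooth_on_tail; [exact: chart_img_open|exact: chart_img_interior].
case: (unliftP ord0 i) => [i'|] ->; case: (unliftP ord0 j) => [j'|] ->.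
- have : smooth_on (cylinder (chart_img c.1))
      (fun y => B (side c.2 (y 0 ord0)) * g c.1 (rv_tail y) i' j').
    by apply: smooth_onM => //; [exact: sB|apply: (tl (fun x => g c.1 x i' j')); exact: gram_smooth].
  by apply: smooth_on_congr => // y _; rewrite /cyl_gram /warped_gram diag1_mxE mxE.
- by apply: smooth_on_congr (smooth_on_cst 0 oC) => // y _; rewrite /cyl_gram /warped_gram diag1_mxE.
- by apply: smooth_on_congr (smooth_on_cst 0 oC) => // y _; rewrite /cyl_gram /warped_gram diag1_mxE.
- have se := tl _ (seta c.1).
  have := smooth_onM oC (sA c.2 oC) (smooth_onM oC se se).
  by apply: smooth_on_congr => // y _; rewrite /cyl_gram /warped_gram diag1_mxE expr2.
Qed.

Lemma cyl_gram_sym (c : chart N) y : chart_img c y -> (cyl_gram c y)^T = cyl_gram c y.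
Proof.
rewrite cyl_img => -[_ Sy]; rewrite /cyl_gram /warped_gram diag1_mx_tr.
by rewrite linearZ /= gram_sym.
Qed.

Lemma cyl_gram_posdef (c : chart N) y (v : 'rV[R]_m.+1) : chart_img c y -> v != 0 ->
  0 < (v *m cyl_gram c y *m v^T) 0 0.
Proof.
rewrite cyl_img => -[y01 Sy] v0; rewrite diag1_mx_form.
have a0 : 0 < A (side c.2 (y 0 ord0)) * eta (chart_inv c.1 (rv_tail y)) ^+ 2.
  by rewrite mulr_gt0 ?exprn_gt0// A_gt0// side01_lt.
rewrite -scalemxAr -scalemxAl mxE.
have b0 : 0 < B (side c.2 (y 0 ord0)) by rewrite B_gt0// side01_lt.
have [t0|t0] := eqVneq (rv_tail v) 0; last first.
  apply: ltr_wpDl; first by rewrite mulr_ge0 ?sqr_ge0// ltW.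
  by apply: mulr_gt0 => //; exact: gram_posdef.
rewrite t0 !mul0mx mxE mulr0 addr0 mulr_gt0// lt_neqAle sqr_ge0 andbT eq_sym sqrf_eq0.
apply: contra_neq v0 => v00; rewrite -[v]rv_tailK v00 t0.
by apply/rowP => i; case: (unliftP ord0 i) => [j|] ->; rewrite ?rv_consS ?rv_cons0 !mxE.
Qed.

(** The transition is [u] or [1 - u] in the first coordinate and a transition of [M] in the others,
    so its Jacobian is block diagonal with first entry 1 or -1. The sign is squared away, and since
    [side] is an involution both charts evaluate [A] and [B] at the same point of the interval. *)
Lemma cyl_gram_transition (c d : chart N) y : chart_img c y ->
  chart_dom d (chart_inv c y) ->
  let tau := fun z => chart_map d (chart_inv c z) in
  cyl_gram c y = Defs.jacobian tau y *m cyl_gram d (tau y) *m (Defs.jacobian tau y)^T.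
Proof.
move=> cy dy tau.
have Oy : cyl_overlap c d y by [].
have oO := cyl_overlap_rel_open bM c d.
have hy := rel_open_half oO Oy.
have tauE z : cyl_overlap c d z -> tau z =
    rv_cons (side d.2 (side c.2 (z 0 ord0))) (chart_map d.1 (chart_inv c.1 (rv_tail z))).
  by move=> Oz; rewrite /tau /= (cyl_transition Oz).
have := Oy; rewrite cyl_overlapE => -[[y01 [Sy dSy]] y1].
have [y0 _] := andP y01.
have ty : open_halfspace (rv_tail y) by exact: chart_img_interior Sy.
set sigma := fun x => chart_map d.1 (chart_inv c.1 x).
have J : Defs.jacobian tau y =
    diag1_mx (side_sign R d.2 * side_sign R c.2) (Defs.jacobian sigma (rv_tail y)).
  apply/matrixP => i k; rewrite [LHS]mxE.
  case: (unliftP ord0 k) => [k'|] ->.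
    rewrite (partial_congr i oO Oy (g := fun z => sigma (rv_tail z) 0 k')); last first.
      by move=> z; rewrite inE => Oz; rewrite tauE// rv_consS.
    case: (unliftP ord0 i) => [i'|] ->; rewrite !diag1_mxE.
      by rewrite (@partial_tail _ _ (fun x => sigma x 0 k'))// mxE.
    exact: is_partialE hy (is_partial_tail0 (fun x => sigma x 0 k') y).
  rewrite (partial_congr i oO Oy (g := fun z => side d.2 (side c.2 (z 0 ord0)))); last first.
    by move=> z; rewrite inE => Oz; rewrite tauE// rv_cons0.
  case: (unliftP ord0 i) => [i'|] ->; rewrite !diag1_mxE.
    exact: is_partialE hy (is_partial_head (fun u => side d.2 (side c.2 u)) i' y).
  apply: is_partialE => //.
  have side_partial b (f : 'rV[R]_m.+1 -> R) l : is_partial ord0 f y l ->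
      is_partial ord0 (fun z => side b (f z)) y (side_sign R b * l).
    case: b => fl; first by rewrite mul1r.
    apply: is_partial_eq (is_partialB (is_partial_cst ord0 1 y) fl).
    by rewrite /side_sign mulN1r sub0r.
  have := side_partial d.2 _ _ (side_partial c.2 _ _ (@is_partial_coord R m.+1 ord0 ord0 y hy)).
  by rewrite eqxx mulr1; apply.
rewrite J diag1_mx_tr tauE// /cyl_gram /warped_gram rv_cons0 rv_consK sideK.
rewrite !diag1_mxM -scalemxAr -scalemxAl; congr (diag1_mx _ _).
  have dK : chart_inv d.1 (sigma (rv_tail y)) = chart_inv c.1 (rv_tail y) by rewrite chart_mapK.
  set e := side_sign R d.2 * side_sign R c.2.
  have ee : e * e = 1 by rewrite /e mulrACA !side_sign_sqr mulr1.
  by rewrite -/(sigma (rv_tail y)) dK mulrAC ee mul1r.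
congr (_ *: _); rewrite -/(sigma (rv_tail y)).
exact: gram_transition.
Qed.

Definition cyl_metric : riemannian_metric N :=
  @RiemannianMetric R m.+1 N cyl_gram cyl_gram_smooth cyl_gram_sym cyl_gram_posdef
    cyl_gram_transition.

Variables A1 B1 B2 : bool -> R -> R.
Hypothesis dA : forall b (y : 'rV[R]_m.+1), halfspace y ->
  is_partial ord0 (fun z => A (side b (z 0 ord0))) y (A1 b (y 0 ord0)).
Hypothesis dB : forall b (y : 'rV[R]_m.+1), halfspace y ->
  is_partial ord0 (fun z => B (side b (z 0 ord0))) y (B1 b (y 0 ord0)).
Hypothesis dB1 : forall b (y : 'rV[R]_m.+1), halfspace y ->
  is_partial ord0 (fun z => B1 b (z 0 ord0)) y (B2 b (y 0 ord0)).

Section AtPoint.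
Variables (p : M) (t : unit_itv R).
Let s := itv_val t.
Let b := s < 2^-1.
Let u := side b s.
Let c := @chart_at _ _ M p.
Let y := @cyl_map _ _ M (c, b) (p, t).

Let y01S : cylinder (chart_img c) y.
Proof. by rewrite -(@cyl_map_image _ _ _ (c, b)); exists (p, t) => //; exact: (@cyl_atP _ _ M (p, t)). Qed.

Let cylinder_half z : cylinder (chart_img c) z -> halfspace z.
Proof. by apply: rel_open_half; apply: rel_open_cylinder; exact: chart_img_open. Qed.

Let y0 : y 0 ord0 = u. Proof. by rewrite rv_cons0. Qed.

Let ty : rv_tail y = chart_map c p. Proof. by rewrite rv_consK. Qed.

Let A_neq0 v : 0 <= v < 1 -> A (side b v) != 0.
Proof. by move=> v01; rewrite gt_eqF// A_gt0// side01_lt. Qed.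

Let B_neq0 v : 0 <= v < 1 -> B (side b v) != 0.
Proof. by move=> v01; rewrite gt_eqF// B_gt0// side01_lt. Qed.

Lemma scalar_curvature_cyl :
  scalar_curvature cyl_metric ((p, t) : N) =
  (B s)^-1 * (scalar_curvature g p - 2 * laplace_beltrami g eta p / eta p) -
  m%:R / (A s * eta p ^+ 2) *
    (B2 b u / B s - 2^-1 * (B1 b u * A1 b u) / (B s * A s) +
     (m%:R - 3) / 4 * (B1 b u / B s) ^+ 2).
Proof.
have := @scalar_curvature_warped R m (chart_img c) (chart_img_open bM (c := c))
  (chart_img_interior bM (c := c)) (g c) (gram_smooth g c) (gram_sym g (c := c)) (@gram_unitmx c)
  (fun x => eta (chart_inv c x)) (seta c) (fun x _ => lt0r_neq0 (eta_gt0 (chart_inv c x)))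
  (fun v => A (side b v)) (fun v => B (side b v)) (A1 b) (B1 b) (B2 b) A_neq0 B_neq0
  (fun z Sz => @dA b _ (cylinder_half Sz)) (fun z Sz => @dB b _ (cylinder_half Sz))
  (fun z Sz => @dB1 b _ (cylinder_half Sz)) y y01S.
by rewrite y0 ty /u sideK chart_mapK//; exact: chart_atP.
Qed.

Lemma mean_curvature_cyl :
  mean_curvature cyl_metric ((p, t) : N) =
  - (m%:R / 2) * (B1 b u / B s) / Num.sqrt (A s * eta p ^+ 2).
Proof.
have := @mean_curvature_warped R m (chart_img c) (chart_img_open bM (c := c))
  (g c) (@gram_unitmx c) (fun x => eta (chart_inv c x))
  (fun x _ => lt0r_neq0 (eta_gt0 (chart_inv c x)))
  (fun v => A (side b v)) (fun v => B (side b v)) (B1 b) A_neq0 B_neq0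
  (fun z Sz => @dB b _ (cylinder_half Sz)) y y01S.
rewrite y0 ty /u sideK chart_mapK; last exact: chart_atP.
by apply; rewrite mulr_gt0 ?exprn_gt0// A_gt0// itv_valP.
Qed.

End AtPoint.

Definition cyl_end (p : M) : N := (p, clamp 1).

Lemma cyl_end_map (d : chart N) p : chart_map d (cyl_end p) = rv_cons (side d.2 1) (chart_map d.1 p).
Proof. by rewrite /= /cyl_map /= itv_val_clamp// ler01 lexx. Qed.

Lemma cyl_end_dom (d : chart N) p : chart_dom d (cyl_end p) -> chart_dom d.1 p.
Proof. by case. Qed.

Lemma cyl_end_isometric : B 1 = 1 -> isometric_embedding g cyl_metric cyl_end.
Proof.
move=> B11; split.
- by move=> p q [].
- split.
    move=> p; have h1 : (fun q : M => q) @ p --> p by exact: cvg_id.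
    have h2 : (fun=> clamp (1 : R)) @ p --> clamp (1 : R) by exact: cvg_cst.
    exact: (cvg_pair h1 h2).
  move=> c d k.
  have sub : [set x | chart_img c x /\ chart_dom d (cyl_end (chart_inv c x))] `<=` chart_overlap c d.1.
    by move=> x [cx /cyl_end_dom].
  apply: (smooth_onW sub).
  have oO : rel_open (chart_overlap c d.1).
    by apply: rel_open_open; [exact: chart_overlap_open|exact: chart_overlap_interior].
  case: (unliftP ord0 k) => [j|] ->.
    rewrite (_ : (fun x => _) = fun x => chart_map d.1 (chart_inv c x) 0 j).
      exact: transition_smooth.
    by apply/funext => x; rewrite cyl_end_map rv_consS.
  rewrite (_ : (fun x => _) = fun=> side d.2 1); first exact: smooth_on_cst.
  by apply/funext => x; rewrite cyl_end_map rv_cons0.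
- move=> c d x cx dx F.
  have dx' := cyl_end_dom dx.
  have FE : F x = rv_cons (side d.2 1) (chart_map d.1 (chart_inv c x)) by rewrite /F cyl_end_map.
  rewrite (@diag1_mx_pullback _ _ _ _ _ _ (Defs.jacobian (fun z => chart_map d.1 (chart_inv c z)) x)).
  (* [side d.2] cancels itself, so whatever the chart [d] the factor in front of [g] is [B 1]. *)
  + by rewrite FE rv_cons0 rv_consK sideK B11 scale1r; exact: gram_transition.
  + move=> i; rewrite mxE (_ : (fun z => F z 0 ord0) = fun=> side d.2 1).
      apply: is_partialE; last exact: is_partial_cst.
      by move=> j j0; apply/ltW; exact: chart_img_interior cx _ _.
    by apply/funext => z; rewrite /F cyl_end_map rv_cons0.
  + move=> i j; rewrite [LHS]mxE [RHS]mxE; congr (partial _ _ _).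
    by apply/funext => z; rewrite /F cyl_end_map rv_consS.
Qed.

End CylinderMetric.

(** * The radial profile *)

Section Profile.
Variables (R : realType) (a beta delta : R).
Hypothesis a_gt0 : 0 < a.
Hypothesis beta_ge0 : 0 <= beta.
Hypothesis delta01 : 0 < delta < 1.

Definition rho (s : R) : R := delta + (1 - delta) * s ^+ 2.
(** The factor A of the metric. As rho'^2 = 4 (1 - delta) (rho - delta), the quotient rho'^2 / A is
    (4 (1 - delta) / a) (1 + beta rho^2) (1 - delta / rho), the slope required of the profile. *)
Definition lapse (s : R) : R := a * (rho s / (1 + beta * rho s ^+ 2)).
Definition warp (s : R) : R := rho s ^+ 2.

(** These derivatives are taken in the chart coordinate [u], not in [s = side b u]: those of first
    order carry the sign of the flag, while in [warp2] it is squared. *)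
Definition rho1 (b : bool) (u : R) : R := 2 * (1 - delta) * side_sign R b * side b u.
Definition lapse1 (b : bool) (u : R) : R :=
  a * (rho1 b u * (1 - beta * rho (side b u) ^+ 2) / (1 + beta * rho (side b u) ^+ 2) ^+ 2).
Definition warp1 (b : bool) (u : R) : R := 2 * (rho (side b u) * rho1 b u).
Definition warp2 (b : bool) (u : R) : R :=
  2 * (rho1 b u ^+ 2 + rho (side b u) * (2 * (1 - delta))).

Lemma rho_gt0 s : 0 < rho s.
Proof.
have [d0 d1] := andP delta01.
by rewrite /rho ltr_pwDl// mulr_ge0 ?sqr_ge0// subr_ge0 ltW.
Qed.

Lemma lapse_denom_gt0 (r : R) : 0 < 1 + beta * r ^+ 2.
Proof. by rewrite ltr_pwDl// mulr_ge0// sqr_ge0. Qed.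

Lemma lapse_gt0 s : 0 < lapse s.
Proof. by rewrite /lapse mulr_gt0// divr_gt0 ?rho_gt0// lapse_denom_gt0. Qed.

Lemma warp_gt0 s : 0 < warp s.
Proof. by rewrite exprn_gt0// rho_gt0. Qed.

Lemma rho_end : rho 1 = 1.
Proof. by rewrite /rho; ring. Qed.

Section Smoothness.
Variable m : nat.
Implicit Types U : set 'rV[R]_m.+1.

Lemma smooth_on_rho U b : rel_open U -> smooth_on U (fun y => rho (side b (y 0 ord0))).
Proof.
move=> oU; apply: smooth_onD => //; first exact: smooth_on_cst.
apply: smooth_onZ => //.
have ss : smooth_on U (fun y => side b (y 0 ord0)).
  by apply: smooth_on_side => //; exact: smooth_on_coord.
by apply: smooth_on_congr (smooth_onM oU ss ss) => // y _; rewrite expr2.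
Qed.

Lemma smooth_on_warp U b : rel_open U -> smooth_on U (fun y => warp (side b (y 0 ord0))).
Proof.
move=> oU; have sr := smooth_on_rho b oU.
by apply: smooth_on_congr (smooth_onM oU sr sr) => // y _; rewrite /warp expr2.
Qed.

Lemma smooth_on_lapse U b : rel_open U -> smooth_on U (fun y => lapse (side b (y 0 ord0))).
Proof.
move=> oU; apply: smooth_onZ => //; apply: smooth_onM => //; first exact: smooth_on_rho.
apply: smooth_onV => //; first by move=> y _; rewrite gt_eqF// lapse_denom_gt0.
apply: smooth_onD => //; first exact: smooth_on_cst.
by apply: smooth_onZ => //; exact: smooth_on_warp.
Qed.

Lemma is_partial_side b (y : 'rV[R]_m.+1) : halfspace y ->
  is_partial ord0 (fun z => side b (z 0 ord0)) y (side_sign R b).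
Proof.
move=> hy; have h := @is_partial_coord R m.+1 ord0 ord0 y hy.
case: b; first by rewrite /side_sign; move: h; rewrite eqxx.
apply: is_partial_eq (is_partialB (is_partial_cst ord0 1 y) h).
by rewrite eqxx sub0r.
Qed.

Lemma is_partial_rho b (y : 'rV[R]_m.+1) : halfspace y ->
  is_partial ord0 (fun z => rho (side b (z 0 ord0))) y (rho1 b (y 0 ord0)).
Proof.
move=> hy; have hs := @is_partial_side b y hy.
apply: is_partial_eq (is_partialD (is_partial_cst ord0 delta y)
  (is_partialZ (c := 1 - delta) (is_partialM hs hs))).
by rewrite /rho1; ring.
Qed.

Lemma is_partial_warp b (y : 'rV[R]_m.+1) : halfspace y ->
  is_partial ord0 (fun z => warp (side b (z 0 ord0))) y (warp1 b (y 0 ord0)).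
Proof.
move=> hy; have hr := @is_partial_rho b y hy.
by apply: is_partial_eq (is_partialM hr hr); rewrite /warp1; ring.
Qed.

Lemma is_partial_warp1 b (y : 'rV[R]_m.+1) : halfspace y ->
  is_partial ord0 (fun z => warp1 b (z 0 ord0)) y (warp2 b (y 0 ord0)).
Proof.
move=> hy; have hr := @is_partial_rho b y hy; have hs := @is_partial_side b y hy.
apply: is_partial_eq (is_partialZ (c := 2) (is_partialM hr
  (is_partialZ (c := 2 * (1 - delta) * side_sign R b) hs))).
rewrite /warp2 /rho1 -[2 * (1 - delta) * side_sign R b * side_sign R b]mulrA side_sign_sqr.
by ring.
Qed.

Lemma is_partial_lapse b (y : 'rV[R]_m.+1) : halfspace y ->
  is_partial ord0 (fun z => lapse (side b (z 0 ord0))) y (lapse1 b (y 0 ord0)).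
Proof.
move=> hy; have hr := @is_partial_rho b y hy.
have hd := is_partialD (is_partial_cst ord0 1 y) (is_partialZ (c := beta) (is_partialM hr hr)).
have d0 := lt0r_neq0 (lapse_denom_gt0 (rho (side b (y 0 ord0)))).
apply: is_partial_eq (is_partialZ (c := a) (is_partialM hr (is_partialV d0 hd))).
by rewrite /lapse1; field.
Qed.

End Smoothness.

(** [K] stands for R_g - 2 H Delta H^-1 and [H2] for H^2; the equation for [q] collects the
    constants in front of the warping terms. These terms are at most r^-2 q ((m - 1) + (m + 1) beta
    r^2): the part in r^-2 is compared with r^-2 K and the constant part with -C, uniformly down to
    the horizon. *)
Lemma profile_curvature_bound (m : nat) (b : bool) (u K H2 C q : R) :
  (2 <= m)%N -> 0 <= side b u <= 1 ->
  0 <= q -> m%:R * (4 * (1 - delta)) * H2 = a * q ->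
  (m%:R - 1) * q < K -> (m%:R + 1) * beta * q <= - C ->
  C < (warp (side b u))^-1 * K - m%:R / (lapse (side b u) * H2^-1) *
    (warp2 b u / warp (side b u) -
     2^-1 * (warp1 b u * lapse1 b u) / (warp (side b u) * lapse (side b u)) +
     (m%:R - 3) / 4 * (warp1 b u / warp (side b u)) ^+ 2).
Proof.
move=> m2 s01 q0 qE hK hC.
set s := side b u in s01 *; set r := rho s.
have r0 : 0 < r := rho_gt0 s.
have rn0 : r != 0 by rewrite gt_eqF.
pose P := 1 + beta * r ^+ 2.
have P0 : 0 < P := lapse_denom_gt0 r.
have Pn0 : P != 0 by rewrite gt_eqF.
have an0 : a != 0 by rewrite gt_eqF.
have [d0 d1] := andP delta01.
have r1E : rho1 b u ^+ 2 = 4 * (1 - delta) * (r - delta).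
  rewrite /rho1 -/s !exprMn [side_sign R b ^+ 2]expr2 side_sign_sqr /r /rho; ring.
(* The terms carrying [delta] only help, because [2 <= m]. *)
pose X := (m%:R - 2) * ((r - delta) * P / r) + P + 2 * beta * r * (r - delta).
have E : m%:R / (lapse s * H2^-1) * (warp2 b u / warp s -
     2^-1 * (warp1 b u * lapse1 b u) / (warp s * lapse s) +
     (m%:R - 3) / 4 * (warp1 b u / warp s) ^+ 2) = (r ^+ 2)^-1 * (q * X).
  (* Since (1 - beta r^2) / P = 1 - 2 beta r^2 / P, the flag survives only in the square of [rho1],
     which [r1E] expresses through r; the factor r - delta there keeps the result regular at the
     horizon. *)
  have -> : warp2 b u / warp s - 2^-1 * (warp1 b u * lapse1 b u) / (warp s * lapse s) +
     (m%:R - 3) / 4 * (warp1 b u / warp s) ^+ 2 =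
     rho1 b u ^+ 2 * ((m%:R - 2) / r ^+ 2 + 2 * beta / P) + 4 * (1 - delta) / r.
    rewrite /warp2 /warp1 /lapse1 /warp /lapse -/s -/r.
    rewrite /P in Pn0 *; field.
    by rewrite Pn0 rn0 an0.
  rewrite r1E /lapse -/r -/P invfM invrK invfM invf_div.
  have qE' : q = m%:R * (4 * (1 - delta)) * H2 / a by rewrite qE mulrC mulKf.
  rewrite qE' /X; field.
  by rewrite rn0 Pn0 an0.
rewrite E /warp -/r -mulrBr.
have rd : delta <= r by rewrite /r /rho lerDl mulr_ge0 ?sqr_ge0// subr_ge0 ltW.
have m2' : 0 <= m%:R - 2 :> R by rewrite subr_ge0 ler_nat.
have XP : X <= (m%:R - 1) + (m%:R + 1) * beta * r ^+ 2.
  have h1 : (r - delta) * P / r <= P.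
    by rewrite ler_pdivrMr// mulrC ler_wpM2l ?(ltW P0)// gerBl ltW.
  have h2 : (m%:R - 2) * ((r - delta) * P / r) <= (m%:R - 2) * P by rewrite ler_wpM2l.
  have h3 : 2 * beta * r * (r - delta) <= 2 * beta * r * r.
    rewrite ler_wpM2l ?gerBl ?(ltW d0)//.
    by rewrite !mulr_ge0// ltW.
  have -> : m%:R - 1 + (m%:R + 1) * beta * r ^+ 2 = (m%:R - 2) * P + P + 2 * beta * r * r.
    by rewrite /P; ring.
  by rewrite !lerD.
have r20 : 0 < r ^+ 2 by rewrite exprn_gt0.
rewrite -ltr_pdivrMl ?invr_gt0// invrK mulrC.
have hX : q * X <= q * ((m%:R - 1) + (m%:R + 1) * beta * r ^+ 2) by rewrite ler_wpM2l.
have hC' : (m%:R + 1) * beta * q * r ^+ 2 <= - C * r ^+ 2 by rewrite ler_wpM2r// ltW.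
lra.
Qed.

End Profile.

(** * Choice of the parameters and verification of the fill-in *)

Theorem theorem1p1 (R : realType) (n : nat) (hn : (3 <= n)%N)
    (Sigma : compact_manifold R n.-1) (hSigma : manifold_boundary Sigma = set0)
    (g : riemannian_metric Sigma)
    (H : Sigma -> R) (hH : smooth_function H) (hHpos : forall p, 0 < H p)
    (C : R) (hC : C < 0)
    (hpos : forall p, 0 < scalar_curvature g p
              - 2 * H p * laplace_beltrami g (fun q => (H q)^-1) p)
    (m1 m2 : R)
    (hm1 : is_max (fun p => (n%:R - 2) / (n%:R - 1) *
              (H p ^+ 2 / (scalar_curvature g p
                 - 2 * H p * laplace_beltrami g (fun q => (H q)^-1) p))) m1)
    (hm2 : is_max (fun p => H p ^+ 2 * area_radius g ^+ 2
                              / (n%:R - 1) ^+ 2) m2)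
    (hmax : Num.max m1 m2 < 1 - C / (n%:R * (n%:R - 1)) * area_radius g ^+ 2) :
  exists (Omega : compact_manifold R n.-1.+1) (gamma : riemannian_metric Omega)
      (Sigma_o Sigma_H : set Omega) (phi : Sigma -> Omega),
    [/\ manifold_boundary Omega = Sigma_o `|` Sigma_H,
        [/\ Sigma_o `&` Sigma_H = set0, Sigma_H !=set0 &
            (connected [set: Sigma] -> connected [set: Omega])],
        [/\ isometric_embedding g gamma phi, range phi = Sigma_o &
            forall p, mean_curvature gamma (phi p) = H p],
        (forall q, Sigma_H q -> mean_curvature gamma q = 0) &
        forall q, C < scalar_curvature gamma q].
Proof.
set m := n.-1 in Sigma hSigma g H hH hHpos hpos hm1 hm2 hmax *.
have m_ge2 : (2 <= m)%N by rewrite /m; case: (n) hn.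
have nE : n%:R = m%:R + 1 :> R by rewrite -(ltn_predK hn) -natr1.
have m0 : 0 < m%:R :> R by rewrite ltr0n; exact: leq_trans m_ge2.
(* A point where the maximum is attained: it shows both that [m1] is positive and, later, that the
   horizon is nonempty. *)
have [p0 hp0] := hm1.1.
pose beta := - C / (m%:R * (m%:R + 1)) * area_radius g ^+ 2.
have beta_ge0 : 0 <= beta.
  by rewrite mulr_ge0 ?sqr_ge0// divr_ge0 ?oppr_ge0 ?(ltW hC)// mulr_ge0 ?addr_ge0 ?(ltW m0).
have {hmax} : Num.max m1 m2 < 1 + beta.
  move: hmax; rewrite nE /beta [(m%:R + 1 - 1)]addrK [(m%:R + 1) * m%:R]mulrC; lra.
rewrite gt_max => /andP[hm1D hm2D].
have [m1_gt0 hK] : 0 < m1 /\ forall p, (m%:R - 1) * H p ^+ 2 <= m1 * m%:R *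
    (scalar_curvature g p - 2 * H p * laplace_beltrami g (fun q => (H q)^-1) p).
  have key : (n%:R - 2) / (n%:R - 1) = (m%:R - 1) / m%:R :> R.
    by rewrite nE; congr (_ / _); ring.
  split.
    rewrite -hp0 key mulr_gt0// divr_gt0 ?exprn_gt0//.
    by rewrite subr_gt0 ltr1n.
  move=> p; have := hm1.2 p; rewrite key mulrA ler_pdivrMr//.
  by rewrite [_ / _ * _]mulrAC ler_pdivrMr// [m1 * _ * m%:R]mulrAC.
pose D := 1 + beta; have D0 : 0 < D by rewrite ltr_pwDl.
pose mx := Num.max m1 m2.
have mxD : mx < D by rewrite gt_max hm1D.
have mx0 : 0 < mx by rewrite lt_max m1_gt0.
(* Makes (1 - delta) D the midpoint of [mx] and D, so both maxima stay strictly below it, while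
   [delta] is positive because [mx < D]. *)
pose delta := (D - mx) / (2 * D).
have kD : (1 - delta) * D = (D + mx) / 2.
  by rewrite /delta; field; rewrite gt_eqF.
have delta01 : 0 < delta < 1.
  rewrite divr_gt0 ?subr_gt0 ?mulr_gt0//= ltr_pdivrMr ?mulr_gt0// mul1r.
  lra.
have [d0 d1] := andP delta01.
have k0 : 0 < 1 - delta by rewrite subr_gt0.
have m1k : m1 < (1 - delta) * D.
  apply: (@le_lt_trans _ _ mx); first by rewrite le_max lexx.
  rewrite kD; lra.
have m2k : m2 < (1 - delta) * D.
  apply: (@le_lt_trans _ _ mx); first by rewrite le_max lexx orbT.
  rewrite kD; lra.
(* At s = 1, where rho = 1, the mean curvature is 2 m (1 - delta) H / sqrt(a / D); this value of [a]
   makes it equal to H. *)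
pose a := 4 * m%:R ^+ 2 * (1 - delta) ^+ 2 * D.
have a_gt0 : 0 < a by rewrite /a !mulr_gt0 ?exprn_gt0.
pose eta p := (H p)^-1.
have eta_gt0 p : 0 < eta p by rewrite invr_gt0.
have seta : smooth_function eta.
  move=> c; apply: smooth_onV.
  - by apply: rel_open_open; [exact: chart_img_open|exact: chart_img_interior].
  - by move=> x _; rewrite gt_eqF.
  - exact: hH.
have A0 s (_ : 0 <= s <= 1) := lapse_gt0 a_gt0 beta_ge0 delta01 s.
have B0 s (_ : 0 <= s <= 1) := warp_gt0 delta01 s.
pose Omega := cyl_manifold hSigma.
have sA (U : set 'rV[R]_m.+1) b (oU : rel_open U) :
    smooth_on U (fun y => lapse a beta delta (side b (y 0 ord0))).
  exact: smooth_on_lapse.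
have sB (U : set 'rV[R]_m.+1) b (oU : rel_open U) :
    smooth_on U (fun y => warp delta (side b (y 0 ord0))).
  exact: smooth_on_warp.
have dA b (y : 'rV[R]_m.+1) : halfspace y ->
    is_partial ord0 (fun z => lapse a beta delta (side b (z 0 ord0))) y (lapse1 a beta delta b (y 0 ord0)).
  by move=> hy; exact: is_partial_lapse.
have dB b (y : 'rV[R]_m.+1) : halfspace y ->
    is_partial ord0 (fun z => warp delta (side b (z 0 ord0))) y (warp1 delta b (y 0 ord0)).
  by move=> hy; exact: is_partial_warp.
have dB1 b (y : 'rV[R]_m.+1) : halfspace y ->
    is_partial ord0 (fun z => warp1 delta b (z 0 ord0)) y (warp2 delta b (y 0 ord0)).
  by move=> hy; exact: is_partial_warp1.
pose gamma := cyl_metric hSigma g seta eta_gt0 A0 B0 sA sB.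
have scalE p t := scalar_curvature_cyl hSigma g seta eta_gt0 A0 B0 sA sB dA dB dB1 p t.
have meanE p t := mean_curvature_cyl hSigma g seta eta_gt0 A0 B0 sA sB dB p t.
have itv1 : itv_val (clamp 1) = 1 :> R by rewrite itv_val_clamp// ler01 lexx.
have itv0 : itv_val (clamp 0) = 0 :> R by rewrite itv_val_clamp// ler01 lexx.
exists Omega, gamma, [set p : Omega | itv_val p.2 = 1], [set p : Omega | itv_val p.2 = 0],
  (cyl_end hSigma); split.
- exact: cyl_boundary.
- split.
  + by apply/seteqP; split=> // p [/= -> /eqP]; rewrite oner_eq0.
  + by exists (p0, clamp 0).
  + by move=> cS; apply: prod_connected => //; exact: unit_itv_connected.
- split.
  + by apply: cyl_end_isometric; rewrite /warp rho_end expr1n.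
  + apply/seteqP; split=> [_ [p _ <-]|[p t] /= t1]; first exact: itv1.
    by exists p => //; congr (_, _); apply: itv_val_inj; rewrite itv1 t1.
  + move=> p; rewrite /cyl_end meanE itv1.
    (* The outer end is read with flag [false] at [u = 0]: there rho decreases in [u], which offsets
       the minus sign of the mean curvature formula. *)
    have -> : (1 < 2^-1 :> R) = false.
      by apply/negbTE; rewrite -leNgt invf_le1// ler1n.
    rewrite /warp1 /warp /lapse /rho1 /side /side_sign subrr subr0 rho_end.
    have -> : a * (1 / (1 + beta * 1 ^+ 2)) * eta p ^+ 2 = (2 * m%:R * (1 - delta) / H p) ^+ 2.
      by rewrite /eta /a /D; field; rewrite !gt_eqF.
    rewrite sqrtr_sqr ger0_norm; last by rewrite ltW// divr_gt0 ?hHpos// !mulr_gt0.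
    by field; rewrite !gt_eqF.
- move=> [p t] /= t0; rewrite meanE t0.
  have -> : (0 < 2^-1 :> R) = true by rewrite invr_gt0 ltr0n.
  (* [rho1] carries the factor [s], which vanishes at the horizon. *)
  by rewrite /warp1 /rho1 /side !(mulr0, mul0r).
- move=> [p t]; rewrite scalE /eta invrK.
  set b := itv_val t < 2^-1; set u := side b (itv_val t).
  have tE : itv_val t = side b u by rewrite /u sideK.
  rewrite [in X in _ < X - _]mulrAC.
  (* For the chosen [a], the equation m (4 (1 - delta)) H^2 = a q has the solution q = H^2 / (m (1 -
     delta) D). *)
  have := @profile_curvature_bound R a beta delta a_gt0 beta_ge0 delta01 m b u
    (scalar_curvature g p - 2 * H p * laplace_beltrami g (fun q => (H q)^-1) p) (H p ^+ 2) C
    (H p ^+ 2 / (m%:R * ((1 - delta) * D))) m_ge2.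
  rewrite -tE exprVn; apply.
  + exact: itv_valP.
  + by rewrite divr_ge0 ?sqr_ge0// !mulr_ge0// ltW.
  + by rewrite /a; field; rewrite !gt_eqF.
  (* First maximum: (m - 1) H^2 <= m1 m K < (1 - delta) D m K, the last step because K > 0. *)
  + rewrite [(m%:R - 1) * _]mulrA ltr_pdivrMr ?mulr_gt0//; apply: le_lt_trans (hK p) _.
    by rewrite mulrC ltr_pM2l// mulrC ltr_pM2l.
  + have := hm2.2 p; rewrite nE addrK => h2.
    have h3 : H p ^+ 2 * area_radius g ^+ 2 / m%:R ^+ 2 <= (1 - delta) * D.
      by apply: le_trans h2 _; exact: ltW.
    rewrite [(m%:R + 1) * beta * _]mulrA ler_pdivrMr ?mulr_gt0//.
    (* The factor r_o^2 in [beta] turns the left side into a multiple of H^2 r_o^2 / (n - 1)^2, the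
       quantity bounded by the second maximum. *)
    have -> : (m%:R + 1) * beta * H p ^+ 2 =
        - C * m%:R * (H p ^+ 2 * area_radius g ^+ 2 / m%:R ^+ 2).
      rewrite /beta; field; rewrite gt_eqF//= gt_eqF// addr_gt0//.
    rewrite -[- C * _ * _]mulrA ler_pM2l ?oppr_gt0//.
    by rewrite ler_pM2l.
Qed.
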